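(* Let $V$ be a complex symplectic vector space of dimension $4$ and let $Z=\{B\in\mathfrak{sp}(V): B^2=0\}$. Then the $\mathcal{O}_Z$-module $T^1_Z$ is pure of dimension $4$.
   Context: $\mathfrak{sp}(V)$ is the symplectic Lie algebra of $V$, and $Z\subset\mathfrak{sp}(V)$ is the subvariety whose ideal $I_0\subset\mathbb{C}[\mathfrak{sp}(V)]$ is generated by the coefficients of the matrix $B^2$. The coherent $\mathcal{O}_Z$-module $T^1_Z$ is the cokernel of the natural homomorphism $$\Theta: T_{\mathfrak{sp}(V)}|_Z\to \mathcal{H}om_{\mathcal{O}_Z}(I_0/I_0^2,\mathcal{O}_Z)$$ which sends a vector field $\partial$ to $(f\mapsto \partial(f)|_Z)$. A coherent module is pure of dimension $d$ if its support has dimension $d$ and it has no nonzero coherent submodule whose support has dimension $<d$. *)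

(* Defs.v *)
From HB Require Import structures.
From mathcomp Require Import all_boot all_order all_algebra.
From mathcomp Require Import boolp functions reals complex.
From mathcomp Require Import mpoly.

Set Implicit Arguments.
Unset Strict Implicit.
Unset Printing Implicit Defensive.

Import GRing.Theory.
Local Open Scope ring_scope.
Local Open Scope quotient_scope.

Section QuotientModule.
Variables (R : nzRingType) (M : lmodType R) (N : submodClosed M).

(* Over a ring, [submodClosed] does not inherit from [zmodClosed], which the
   quotient construction of ring_quotient requires. *)
Definition quot_pred : {pred M} := N.

Lemma quot_pred_closed : zmod_closed quot_pred.
Proof. exact/GRing.submod_closedB/submodClosedP. Qed.

HB.instance Definition _ := GRing.isZmodClosed.Build M quot_pred
  quot_pred_closed.

Definition quotmod : Type := {ideal_quot quot_pred}.
HB.instance Definition _ := GRing.Zmodule.on quotmod.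

Definition quotmod_pi (x : M) : quotmod := \pi_({ideal_quot quot_pred}) x.

Lemma quotmod_piP x y : quotmod_pi x = quotmod_pi y <-> x - y \in N.
Proof.
rewrite -[x - y \in N]/(x - y \in quot_pred).
by rewrite (Quotient.idealrBE quot_pred); split=> [/eqP|/eqP].
Qed.

Lemma quotmod_piD : {morph quotmod_pi : x y / x + y}.
Proof. by move=> x y; rewrite /quotmod_pi raddfD. Qed.

Lemma quotmod_reprK x : quotmod_pi (repr x) = x.
Proof. exact: reprK. Qed.

Definition quotmod_scale (a : R) (x : quotmod) : quotmod :=
  quotmod_pi (a *: repr x).

Lemma quotmod_piZ a x : quotmod_scale a (quotmod_pi x) = quotmod_pi (a *: x).
Proof.
by apply/quotmod_piP; rewrite -scalerBr rpredZ //; apply/quotmod_piP/reprK.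
Qed.

Lemma quotmodW (P : quotmod -> Prop) :
  (forall m, P (quotmod_pi m)) -> forall x, P x.
Proof. by move=> Ppi x; rewrite -[x]quotmod_reprK. Qed.

Lemma quotmod_scaleA a b x :
  quotmod_scale a (quotmod_scale b x) = quotmod_scale (a * b) x.
Proof. by elim/quotmodW: x => x; rewrite !quotmod_piZ scalerA. Qed.

Lemma quotmod_scale1 : left_id 1 quotmod_scale.
Proof. by elim/quotmodW => x; rewrite quotmod_piZ scale1r. Qed.

Lemma quotmod_scaleDr : right_distributive quotmod_scale +%R.
Proof.
move=> a; elim/quotmodW => x; elim/quotmodW => y.
by rewrite -quotmod_piD !quotmod_piZ -quotmod_piD scalerDr.
Qed.

Lemma quotmod_scaleDl x : {morph quotmod_scale^~ x : a b / a + b}.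
Proof.
elim/quotmodW: x => x a b.
by rewrite !quotmod_piZ -quotmod_piD scalerDl.
Qed.

HB.instance Definition _ := GRing.Zmodule_isLmodule.Build R quotmod
  quotmod_scaleA quotmod_scale1 quotmod_scaleDr quotmod_scaleDl.

End QuotientModule.

Section HomModule.
Variables (A : comNzRingType) (M N : lmodType A).

Definition is_linear : {pred M -> N} := fun f => `[< linear f >].

Lemma is_linear_closed : subsemimod_closed is_linear.
Proof.
split; first split.
- by apply/asboolP => a u v; rewrite /= scaler0 addr0.
- move=> f g /asboolP lf /asboolP lg; apply/asboolP => a u v.
  by rewrite /GRing.add/= lf lg scalerDr addrACA.
- move=> b f /asboolP lf; apply/asboolP => a u v.
  rewrite -[LHS]/(b *: f (a *: u + v)) -[RHS]/(a *: (b *: f u) + b *: f v).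
  by rewrite lf scalerDr !scalerA mulrC.
Qed.

HB.instance Definition _ :=
  GRing.isSubmodClosed.Build A (M -> N) is_linear is_linear_closed.

Definition hom : Type := {f : M -> N | f \in is_linear}.
HB.instance Definition _ := SubChoice.on hom.
HB.instance Definition _ := [SubChoice_isSubLmodule of hom by <:].

End HomModule.

Section Conormal.
Variables (S : comNzRingType) (I : idealr S).

Definition ideal_elt : Type := {x : S | x \in I}.
HB.instance Definition _ := SubChoice.on ideal_elt.
HB.instance Definition _ := [SubChoice_isSubZmodule of ideal_elt by <:].

Definition ideal_mul (s : S) (x : ideal_elt) : ideal_elt :=
  exist _ (s * val x) (idealMr s (valP x)).

Definition ideal_sq : {pred ideal_elt} := fun x =>
  `[< exists s : seq (ideal_elt * ideal_elt),
        val x = \sum_(p <- s) val p.1 * val p.2 >].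

Lemma ideal_sqD : {in ideal_sq &, forall x y, x + y \in ideal_sq}.
Proof.
move=> x y /asboolP[s xE] /asboolP[t yE]; apply/asboolP; exists (s ++ t).
by rewrite raddfD/= xE yE big_cat.
Qed.

Lemma ideal_sqM a : {in ideal_sq, forall x, ideal_mul a x \in ideal_sq}.
Proof.
move=> x /asboolP[s xE]; apply/asboolP.
exists [seq (ideal_mul a p.1, p.2) | p <- s].
rewrite big_map/= xE mulr_sumr; apply: eq_bigr => p _.
by rewrite mulrA.
Qed.

Lemma ideal_sq_prod (x y : ideal_elt) : ideal_mul (val x) y \in ideal_sq.
Proof. by apply/asboolP; exists [:: (x, y)]; rewrite big_seq1. Qed.

Lemma ideal_sq_closed : zmod_closed ideal_sq.
Proof.
split; first by apply/asboolP; exists [::]; rewrite big_nil.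
move=> x y xI yI; apply: ideal_sqD => //.
suff -> : - y = ideal_mul (-1) y by exact: ideal_sqM.
by apply: val_inj; rewrite /= mulN1r.
Qed.

HB.instance Definition _ := GRing.isZmodClosed.Build ideal_elt ideal_sq
  ideal_sq_closed.

Definition conormal : Type := {ideal_quot ideal_sq}.
HB.instance Definition _ := GRing.Zmodule.on conormal.

Definition conormal_pi (x : ideal_elt) : conormal :=
  \pi_({ideal_quot ideal_sq}) x.

Lemma conormal_piP x y : conormal_pi x = conormal_pi y <-> x - y \in ideal_sq.
Proof. by rewrite (Quotient.idealrBE ideal_sq); split=> [/eqP|/eqP]. Qed.

Lemma conormal_piD : {morph conormal_pi : x y / x + y}.
Proof. by move=> x y; rewrite /conormal_pi raddfD. Qed.

Lemma conormal_reprK x : conormal_pi (repr x) = x.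
Proof. exact: reprK. Qed.

Definition conormal_scale (a : {ideal_quot I}) (x : conormal) : conormal :=
  conormal_pi (ideal_mul (repr a) (repr x)).

Lemma conormal_piZ s x : conormal_scale (\pi_({ideal_quot I}) s)
  (conormal_pi x) = conormal_pi (ideal_mul s x).
Proof.
apply/conormal_piP; set a := repr _; set y := repr _.
have yx : y - x \in ideal_sq by apply/conormal_piP/conormal_reprK.
have as_I : a - s \in I.
  by rewrite Quotient.idealrBE reprK.
suff -> : ideal_mul a y - ideal_mul s x =
  ideal_mul a (y - x) + ideal_mul (a - s) x.
  apply: ideal_sqD; first exact: ideal_sqM.
  exact: (ideal_sq_prod (exist _ (a - s) as_I : ideal_elt)).
apply: val_inj; rewrite /= mulrBr mulrBl.
by rewrite addrA subrK.
Qed.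

Lemma conormalW (P : conormal -> Prop) :
  (forall f, P (conormal_pi f)) -> forall x, P x.
Proof. by move=> Ppi x; rewrite -[x]conormal_reprK. Qed.

Lemma conormal_scaleA a b x :
  conormal_scale a (conormal_scale b x) = conormal_scale (a * b) x.
Proof.
elim/quotW: a => a; elim/quotW: b => b; elim/conormalW: x => x.
rewrite -rmorphM (conormal_piZ b) !conormal_piZ.
by congr conormal_pi; apply: val_inj; rewrite /= mulrA.
Qed.

Lemma conormal_scale1 : left_id 1 conormal_scale.
Proof.
elim/conormalW => x; rewrite -(rmorph1 (\pi_({ideal_quot I}))).
by rewrite conormal_piZ; congr conormal_pi; apply: val_inj; rewrite /= mul1r.
Qed.

Lemma conormal_scaleDr : right_distributive conormal_scale +%R.
Proof.
elim/quotW => a; elim/conormalW => x; elim/conormalW => y.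
rewrite -conormal_piD !conormal_piZ -conormal_piD.
by congr conormal_pi; apply: val_inj; rewrite /= mulrDr.
Qed.

Lemma conormal_scaleDl x : {morph conormal_scale^~ x : a b / a + b}.
Proof.
elim/conormalW: x => x; elim/quotW => a; elim/quotW => b.
rewrite -rmorphD !conormal_piZ -conormal_piD.
by congr conormal_pi; apply: val_inj; rewrite /= mulrDl.
Qed.

HB.instance Definition _ := GRing.Zmodule_isLmodule.Build {ideal_quot I}
  conormal conormal_scaleA conormal_scale1 conormal_scaleDr conormal_scaleDl.

End Conormal.

Section T1.
Variables (C : fieldType) (S : comAlgType C) (I : idealr S).
Local Notation A := {ideal_quot I}.

(* Z = Spec A is affine, so coherent O_Z-modules are finitely generated
   A-modules and sheaf Homs are modules of A-linear maps. *)
Definition normal_module := @hom A (conormal I) A^o.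

Record derivation := Derivation {
  der_fun :> {linear S -> S};
  der_leibniz : forall f g, der_fun (f * g) = f * der_fun g + g * der_fun f
}.

Definition theta_fun (d : derivation) (x : conormal I) : A :=
  \pi_A (d (val (repr x))).

Lemma theta_fun_pi d (f : ideal_elt I) :
  theta_fun d (conormal_pi f) = \pi_A (d (val f)).
Proof.
apply/eqP; rewrite -Quotient.idealrBE -raddfB/=.
have /asboolP[s sE] : repr (conormal_pi f) - f \in @ideal_sq S I.
  by apply/conormal_piP/conormal_reprK.
have -> : val (repr (conormal_pi f)) - val f =
  \sum_(p <- s) val p.1 * val p.2 by exact: sE.
rewrite linear_sum rpred_sum // => p _; rewrite der_leibniz.
by apply: rpredD; rewrite mulrC; apply: idealMr;
  [exact: (valP p.1) | exact: (valP p.2)].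
Qed.

Lemma theta_linear d : theta_fun d \in @is_linear A (conormal I) A^o.
Proof.
apply/asboolP => a u v.
elim/quotW: a => a; elim/conormalW: u => f; elim/conormalW: v => g.
rewrite -[_ *: conormal_pi f]/(conormal_scale _ _) conormal_piZ -conormal_piD.
rewrite !theta_fun_pi /= linearD der_leibniz !rmorphD !rmorphM/=.
have -> : \pi_A (val f) = 0.
  apply/eqP; rewrite -(rmorph0 (\pi_A)) -Quotient.idealrBE subr0.
  exact: valP.
by rewrite mul0r addr0.
Qed.

Definition theta (d : derivation) : normal_module :=
  exist (fun f => f \in @is_linear A (conormal I) A^o) _ (theta_linear d).

(* T_{Spec S}|_Z is Der_C(S) (x)_S A.  Since S -> A is onto, the image of Theta
   is already reached by the derivations of S. *)
Definition theta_image : {pred normal_module} := fun phi =>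
  `[< exists d, phi = theta d >].

Lemma theta_image_closed : subsemimod_closed theta_image.
Proof.
split; first split.
- have L0 (f g : S) : (\0 : S -> S) (f * g) = f * \0 g + g * \0 f.
    by rewrite /= !mulr0 addr0.
  apply/asboolP; exists (@Derivation (\0 : {linear S -> S}) L0).
  by apply: val_inj; apply/funext => x; rewrite /= /theta_fun/= rmorph0.
- move=> _ _ /asboolP[d ->] /asboolP[e ->].
  pose D : {linear S -> S} := d \+ e.
  have LD (f g : S) : D (f * g) = f * D g + g * D f.
    by rewrite /= !der_leibniz !mulrDr addrACA.
  apply/asboolP; exists (Derivation LD).
  by apply: val_inj; apply/funext => x; rewrite /= /theta_fun/= rmorphD.
- move=> a _ /asboolP[d ->]; elim/quotW: a => a.
  pose D : {linear S -> S} := a \*o d.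
  have LD (f g : S) : D (f * g) = f * D g + g * D f.
    by rewrite /= der_leibniz mulrDr mulrCA [a * (g * _)]mulrCA.
  apply/asboolP; exists (Derivation LD).
  by apply: val_inj; apply/funext => x; rewrite /= /theta_fun/= rmorphM.
Qed.

HB.instance Definition _ := GRing.isSubmodClosed.Build A normal_module
  theta_image theta_image_closed.

Definition T1 : lmodType A := quotmod theta_image.

End T1.

Section Purity.
Variables (A : comNzRingType) (M : lmodType A).
Implicit Types (N : {pred M}) (X : prime_idealr A -> Prop).

(* The stalk N_p is nonzero iff some m in N has nonzero image in M_p, i.e. is
   killed by no element outside p. *)
Definition support N : prime_idealr A -> Prop := fun p =>
  exists2 m, m \in N & forall a, a *: m = 0 -> a \in p.

(* Chains of primes in X are chains of irreducible closed subsets of X when X is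
   closed, so this is Krull dimension.  The empty set has dimension < n for
   every n. *)
Definition dim_ge X (n : nat) : Prop :=
  exists p : nat -> prime_idealr A,
    (forall i, (i <= n)%N -> X (p i)) /\
    (forall i, (i < n)%N ->
       {subset p i <= p i.+1} /\ ~ {subset p i.+1 <= p i}).

Definition has_dim X n := dim_ge X n /\ ~ dim_ge X n.+1.

Definition dim_lt X n := ~ dim_ge X n.

Definition finitely_generated N := exists n (g : 'I_n -> M),
  forall m, m \in N <-> exists a : 'I_n -> A, m = \sum_i a i *: g i.

Definition pure (d : nat) : Prop :=
  has_dim (support predT) d /\
  forall N : submodClosed M, finitely_generated N ->
    (exists2 m, m \in N & m != 0) -> ~ dim_lt (support N) d.

End Purity.

Section SquareZero.
Variables (C : fieldType) (V : vectType C) (omega : {skew_symmetric V}).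
Let e := vbasis {:V}.

(* sp(V), as the kernel of a linear map so as to be a {vspace _}; see [mem_sp]
   for the usual description. *)
Definition sp_defect (f : 'End(V)) : 'M[C]_(\dim {:V}) :=
  \matrix_(i, j) (omega (f e`_i) e`_j + omega e`_i (f e`_j)).

Definition sp : {vspace 'End(V)} := lker (linfun sp_defect).

Lemma sp_defect_linear : linear sp_defect.
Proof.
move=> a f g; apply/matrixP => i j; rewrite !mxE !lfunE/= !lfunE/=.
rewrite linearDl linearDr linearZl_LR linearZr_LR /=.
by rewrite mulrDr addrACA.
Qed.

HB.instance Definition _ := GRing.isLinear.Build _ _ _ _ sp_defect
  sp_defect_linear.

Lemma omega_coord (g h : 'End(V)) u v : omega (g u) (h v) =
  \sum_i \sum_j coord e i u * coord e j v * omega (g e`_i) (h e`_j).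
Proof.
rewrite [in LHS](coord_vbasis (memvf u)) [in LHS](coord_vbasis (memvf v)).
rewrite (linear_sum g) (linear_sum h) linear_sumlz; apply: eq_bigr => i _.
rewrite linear_sumr; apply: eq_bigr => j _.
rewrite (linearZ_LR g) (linearZ_LR h) /=.
by rewrite linearZl_LR linearZr_LR /= mulrA.
Qed.

Lemma mem_sp f :
  f \in sp <-> forall u v, omega (f u) v + omega u (f v) = 0.
Proof.
rewrite memv_ker lfunE/=; split=> [/eqP f0 u v|f0]; last first.
  by apply/eqP/matrixP => i j; rewrite !mxE f0.
have -> : omega (f u) v = omega (f u) (\1%VF v) by rewrite id_lfunE.
have -> : omega u (f v) = omega (\1%VF u) (f v) by rewrite id_lfunE.
rewrite !omega_coord -big_split/= big1 // => i _.
rewrite -big_split/= big1 // => j _; rewrite !id_lfunE -mulrDr.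
by have /matrixP/(_ i j) := f0; rewrite !mxE => ->; rewrite mulr0.
Qed.

Local Notation n := (\dim sp).

(* 'X_k is the k-th linear coordinate on sp(V) in the basis [vbasis sp], and
   [sp_generic] is the matrix in the basis [e] of V (acting on columns) of the
   universal element \sum_k 'X_k (vbasis sp)_k of sp(V). *)
Definition sp_coord_ring : comAlgType C := {mpoly C[n]}.

Definition sp_generic : 'M[sp_coord_ring]_(\dim {:V}) :=
  \matrix_(i, j)
    \sum_(k < n) coord e i ((vbasis sp)`_k e`_j) *: ('X_k : {mpoly C[n]}).

Definition sqzero_ideal : {pred sp_coord_ring} := fun p =>
  `[< exists c : 'M[sp_coord_ring]_(\dim {:V}),
        p = \sum_i \sum_j c i j * (sp_generic *m sp_generic) i j >].

Lemma sp_generic_at0 i j : ((sp_generic *m sp_generic) i j).@[fun=> 0] = 0.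
Proof.
rewrite mxE rmorph_sum big1 //= => k _; rewrite mevalM mxE rmorph_sum big1 ?mul0r //.
by move=> l _; rewrite /= mevalZ mevalXU mulr0.
Qed.

Lemma sqzero_ideal_closed : idealr_closed sqzero_ideal.
Proof.
split.
- apply/asboolP; exists 0; rewrite big1 // => i _; rewrite big1 // => j _.
  by rewrite mxE mul0r.
- apply/asboolP => -[c] /(congr1 (meval (fun=> 0))); rewrite meval1.
  rewrite rmorph_sum big1 => [/eqP|i _]; first by rewrite oner_eq0.
  rewrite /= rmorph_sum big1 // => j _ /=.
  by rewrite mevalM sp_generic_at0 mulr0.
- move=> a _ _ /asboolP[c ->] /asboolP[d ->]; apply/asboolP.
  exists (a *: c + d); rewrite mulr_sumr -big_split; apply: eq_bigr => i _ /=.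
  rewrite mulr_sumr -big_split; apply: eq_bigr => j _ /=.
  by rewrite !mxE mulrDl mulrA.
Qed.

HB.instance Definition _ := isIdealr.Build sp_coord_ring sqzero_ideal
  sqzero_ideal_closed.

End SquareZero.
Arguments sqzero_ideal {C V} omega _.

(* Main.v *)
Require Import Defs.
From HB Require Import structures.
From mathcomp Require Import all_boot all_order all_algebra.
From mathcomp Require Import boolp functions reals complex.
From mathcomp Require Import mpoly.
From mathcomp Require Import ring zify.

(** In a symplectic basis of V, with J = [[0, 1], [-1, 0]], an element of sp(V)
    is a symmetric 4 x 4 matrix S = [[a, b], [b^T, d]], and B^2 = 0 becomes
    S J S = 0: six quadrics, the entries above the diagonal of a skew matrix.
    Call I their ideal and A the quotient ring.  A homomorphism from I/I^2 to A
    is a skew matrix Psi over A killed by the syzygies of the quadrics; those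
    coming from vector fields are the matrices T J S + S J T with T symmetric.

    The theorem holds because T^1 is cyclic with a prime annihilator.  Its
    generator is the class of eps : S J S |-> J, the direction of the flat
    deformation B^2 = t.  Its annihilator is the ideal P of the cone of rank one
    matrices x x^T, which is the second Veronese cone over P^3 and has dimension
    4.  So T^1 is A/P, every nonzero element has annihilator P, and every
    nonzero submodule has support Spec(A/P).

    Every Hom is A eps plus vector fields ([linear_syzygies_split]).  Of the
    syzygies of S J S only the linear ones, the entries of S J Psi - Psi J S,
    are needed.  One of them says that the entries
    (1,2), (1,4), (2,3) of Psi and the difference of its entries (1,3) and
    (2,4) form, up to signs, a syzygy over A of (b11 + b22, a22, a11, a12); these
    syzygies are generated by the ten constant vector fields ([syz_kernel]).  The
    sum of the entries (1,3) and (2,4) is adjusted by a multiple of J, and a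
    second linear syzygy takes care of the last entry.  The computation takes place in
    the chart of Lagrangian graphs b = a c, d = c a c, where A embeds in the
    polynomial ring in the entries of a and c ([chart_kernel]).  Both kernels
    are found in the same way: the known relations rewrite every element into a
    combination of normal monomials ([rules_normal_form]), and the images of
    normal monomials in the chart have distinct leading monomials
    ([normal_inj]).

    The annihilator of eps is P ([eps_class_ann]).  Substituting S = x x^T, the
    matrix T J S + S J T has rank at most 2 while J has rank 4, so f eps can
    come from a vector field only if f vanishes on the cone; conversely the
    2 x 2 minors generate P, and each minor times J is T J S + S J T modulo I for
    an explicit T linear in S ([minor_field]).  That eps is well defined follows
    too: a minor, which is a nonzero divisor, times eps is the restriction of a
    vector field ([syzygy_jvec]).

    Chains of primes above P come from the coordinate subspaces of C^4.  A
    longer chain is impossible because five elements of C[x1, ..., x4] are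
    algebraically dependent ([algebraic_dependence]), whereas the elements
    separating consecutive primes of a chain are independent modulo the
    smallest prime ([chain_independent]). *)

Set Implicit Arguments.
Unset Strict Implicit.
Unset Printing Implicit Defensive.

Import GRing.Theory.
Local Open Scope ring_scope.

(** * Normal forms and leading monomials *)

Section Weights.
Variables (K : fieldType) (n : nat) (wt : 'I_n -> nat).

Definition wgt (m : 'X_{1..n}) : nat := (\sum_i m i * wt i)%N.

Lemma wgtD (m m' : 'X_{1..n}) : wgt (m + m')%MM = (wgt m + wgt m')%N.
Proof. by rewrite /wgt -big_split; apply: eq_bigr => i _; rewrite mnmDE mulnDl. Qed.

Definition below (d : nat) (f : {mpoly K[n]}) : Prop :=
  forall m, m \in msupp f -> (wgt m < d)%N.

Lemma below0 d : below d 0.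
Proof. by move=> m; rewrite msupp0. Qed.

Lemma belowD d f g : below d f -> below d g -> below d (f + g).
Proof.
by move=> hf hg m /msuppD_le; rewrite mem_cat => /orP[/hf|/hg].
Qed.

Lemma below_sum d (T : eqType) (r : seq T) (F : T -> {mpoly K[n]}) :
  (forall x, x \in r -> below d (F x)) -> below d (\sum_(x <- r) F x).
Proof.
move=> h; rewrite big_seq; elim/big_ind: _ => //; first exact: below0.
exact: belowD.
Qed.

Lemma belowZ d c f : below d f -> below d (c *: f).
Proof.
move=> h m; rewrite mcoeff_msupp mcoeffZ => hm; apply: h.
by rewrite mcoeff_msupp; apply: contraNneq hm => ->; rewrite mulr0.
Qed.

Lemma belowX d m : (wgt m < d)%N -> below d 'X_[m].
Proof. by move=> h m'; rewrite msuppX inE => /eqP->. Qed.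

Lemma below_leq d e f : (d <= e)%N -> below d f -> below e f.
Proof. by move=> h hf m /hf hm; apply: leq_trans hm h. Qed.

Lemma belowMX d m f : below d f -> below (wgt m + d) ('X_[m] * f).
Proof.
move=> hf; rewrite [f]mpolyE mulr_sumr; apply: below_sum => m' /hf h.
rewrite -scalerAr -mpolyXD; apply/belowZ/belowX.
by rewrite wgtD ltn_add2l.
Qed.

Lemma belowM d e f g : below d f -> below e g -> below (d + e) (f * g).
Proof.
move=> hf hg; rewrite [f]mpolyE mulr_suml; apply: below_sum => m' /hf h.
rewrite -scalerAl; apply/belowZ; apply: below_leq (belowMX hg).
by rewrite leq_add2r ltnW.
Qed.

(** A leading monomial with coefficient one.  The weight is not a monomial order:
    the other monomials have to be strictly lighter, which makes the notion
    multiplicative. *)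
Definition leads (f : {mpoly K[n]}) (s : 'X_{1..n}) : Prop :=
  below (wgt s) (f - 'X_[s]).

Lemma leadsX s : leads 'X_[s] s.
Proof. by rewrite /leads subrr; exact: below0. Qed.

Lemma leads1 : leads 1 0%MM.
Proof. by rewrite -[1]mpolyX0; exact: leadsX. Qed.

Lemma leadsM f g s t : leads f s -> leads g t -> leads (f * g) (s + t)%MM.
Proof.
rewrite /leads wgtD => hf hg.
have -> : f * g - 'X_[s + t] =
  'X_[s] * (g - 'X_[t]) + (f - 'X_[s]) * 'X_[t] + (f - 'X_[s]) * (g - 'X_[t]).
  by rewrite mpolyXD !mulrBl !mulrBr; rewrite !addrA !opprB; ring.
apply: belowD; last exact: belowM.
apply: belowD; first exact: belowMX.
rewrite [_ * 'X_[t]]mulrC addnC; exact: belowMX.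
Qed.

Lemma leadsXn f s k : leads f s -> leads (f ^+ k) (s *+ k)%MM.
Proof.
move=> h; elim: k => [|k IH]; first by rewrite expr0 mulm0n; exact: leads1.
by rewrite exprS mulmS; exact: leadsM.
Qed.

Lemma leads_coef f s m : leads f s -> (wgt s <= wgt m)%N ->
  f@_m = (m == s)%:R.
Proof.
move=> h hm; have -> : f = 'X_[s] + (f - 'X_[s]) by rewrite addrC subrK.
rewrite mcoeffD mcoeffX eq_sym [(f - _)@_m]memN_msupp_eq0 ?addr0 //.
by apply/negP => /h; rewrite ltnNge hm.
Qed.

End Weights.

Section Rewriting.
Variables (K : fieldType) (n k : nat).
Local Notation S := {mpoly K[n]}.
Local Notation vec := 'rV[S]_k.
Variables (wt : 'I_n -> nat) (vt : 'I_k -> nat).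
Variables (U : vec -> Prop) (nf : 'X_{1..n} -> 'I_k -> bool).
Hypotheses (U0 : U 0) (UD : forall F G, U F -> U G -> U (F + G)).
Hypothesis UZ : forall (c : S) F, U F -> U (c *: F).

Definition vbelow (d : nat) (F : vec) : Prop :=
  forall i m, m \in msupp (F 0 i) -> (wgt wt m + vt i < d)%N.

Lemma vbelowD d F G : vbelow d F -> vbelow d G -> vbelow d (F + G).
Proof.
move=> hF hG i m; rewrite mxE => /msuppD_le; rewrite mem_cat => /orP[].
  exact: hF.
exact: hG.
Qed.

Lemma vbelow0 d : vbelow d 0.
Proof. by move=> i m; rewrite mxE msupp0. Qed.

Lemma vbelow_delta d f i : (forall m, m \in msupp f -> (wgt wt m + vt i < d)%N) ->
  vbelow d (f *: delta_mx 0 i).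
Proof.
move=> h j m; rewrite !mxE eqxx /=; case: eqP => [->|_].
  by rewrite mulr1; exact: h.
by rewrite mulr0 msupp0.
Qed.

Hypothesis reduce : forall m i, ~~ nf m i -> exists2 G : vec,
  U ('X_[m] *: delta_mx 0 i - G) & vbelow (wgt wt m + vt i) G.

Definition normal_vec (F : vec) : Prop :=
  forall i m, m \in msupp (F 0 i) -> nf m i.

(** A reduction step replaces a monomial that is not normal by lighter ones, so
    rewriting modulo [U] ends, by induction on a bound for the weights. *)
Lemma normal_form (F : vec) : exists2 G, U (F - G) & normal_vec G.
Proof.
have [d hd] : exists d, vbelow d F.
  exists (\max_i \max_(m <- msupp (F 0%R i)) (wgt wt m + vt i)).+1 => i m hm.
  rewrite ltnS; apply: leq_trans (leq_bigmax i).
  exact: (leq_bigmax_seq (F := fun m => (wgt wt m + vt i)%N)).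
elim/ltn_ind: d F hd => d IH F hd.
have sumP (T : eqType) (r : seq T) (E : T -> vec) :
    (forall x, x \in r -> exists2 G, U (E x - G) & normal_vec G) ->
  exists2 G, U (\sum_(x <- r) E x - G) & normal_vec G.
  elim: r => [|x r IHr] h.
    exists 0; first by rewrite big_nil subr0.
    by move=> i m; rewrite mxE msupp0.
  have [G UG nG] := h x (mem_head _ _).
  have [G' UG' nG'] : exists2 G, U (\sum_(x <- r) E x - G) & normal_vec G.
    by apply: IHr => y hy; apply: h; rewrite in_cons hy orbT.
  exists (G + G'); first by rewrite big_cons opprD addrACA; exact: UD.
  move=> i m; rewrite mxE => /msuppD_le; rewrite mem_cat => /orP[].
    exact: nG.
  exact: nG'.
have -> : F = \sum_(i <- enum 'I_k) \sum_(m <- msupp (F 0 i))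
    (((F 0 i)@_m)%:MP * 'X_[m]) *: delta_mx 0 i.
  rewrite [LHS]row_sum_delta big_enum /=; apply: eq_bigr => i _.
  rewrite -scaler_suml; congr (_ *: _); rewrite [LHS]mpolyE.
  by apply: eq_bigr => m _; rewrite mul_mpolyC.
apply: (sumP) => i _; apply: (sumP) => m hm.
case nfm : (nf m i).
  exists (((F 0 i)@_m)%:MP * 'X_[m] *: delta_mx 0 i); first by rewrite subrr.
  move=> j m'; rewrite !mxE eqxx /=; case: eqP => [->|_]; last by rewrite mulr0 msupp0.
  by rewrite mulr1 mul_mpolyC => /msuppZ_le; rewrite msuppX inE => /eqP->.
have [G UG hG] := reduce (negbT nfm).
have [G' UG' nG'] := IH _ (hd i m hm) _ hG.
exists (((F 0 i)@_m)%:MP *: G').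
  rewrite -scalerA -scalerBr; apply: UZ.
  rewrite -[_ - G'](subrKA G); exact: UD.
by move=> j m'; rewrite mxE mul_mpolyC => /msuppZ_le; exact: nG'.
Qed.

End Rewriting.

Section Independence.
Variables (K : fieldType) (n k r : nat).
Local Notation S := {mpoly K[n]}.
Variables (om : 'I_r -> nat) (nf : 'X_{1..n} -> 'I_k -> bool).
Variables (x : n.-tuple {mpoly K[r]}) (y : 'I_k -> {mpoly K[r]}).
Variables (mu : 'I_n -> 'X_{1..r}) (nu : 'I_k -> 'X_{1..r}).
Hypotheses (hx : forall j, leads om (tnth x j) (mu j)).
Hypotheses (hy : forall i, leads om (y i) (nu i)).

(** The leading monomial of the image of the monomial [m] in position [i]. *)
Definition img_lead (m : 'X_{1..n}) (i : 'I_k) : 'X_{1..r} :=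
  ((\sum_j mu j *+ m j) + nu i)%MM.

Hypothesis inj : forall m i m' i', nf m i -> nf m' i' ->
  img_lead m i = img_lead m' i' -> m = m' /\ i = i'.

Lemma leads_img m i : leads om (('X_[m] \mPo x) * y i) (img_lead m i).
Proof.
apply: leadsM => //; rewrite comp_mpolyX.
elim/big_rec2: _ => [|j s f _ IH]; first exact: leads1.
by apply: leadsM => //; exact: leadsXn.
Qed.

(** In a relation between images of normal monomials, the heaviest leading
    monomial occurs only once and cannot cancel. *)
Lemma normal_inj (F : 'rV[S]_k) : normal_vec nf F ->
  \sum_i (F 0 i \mPo x) * y i = 0 -> F = 0.
Proof.
move=> nF F0; apply/eqP; apply: contraT => /rV0Pn[i0 Fi0].
pose P : pred ('I_k * 'X_{1..n}) := fun p => p.2 \in msupp (F 0 p.1).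
pose s := [seq (i, m) | i <- enum 'I_k, m <- msupp (F 0 i)].
pose W (p : 'I_k * 'X_{1..n}) := wgt om (img_lead p.2 p.1).
have memS p : (p \in s) = P p.
  apply/allpairsPdep/idP => [[i [m [_ hm ->]]]//|].
  by case: p => i m hm; exists i, m; rewrite mem_enum.
have [p ps pmax] : exists2 p, p \in s & forall q, q \in s -> (W q <= W p)%N.
  have : s != [::].
    apply/eqP => s0; have := memS (i0, mlead (F 0 i0)).
    by rewrite s0 /P /= mlead_supp.
  elim: (s) => // a [|b l] IH _.
    by exists a; [exact: mem_head|move=> q; rewrite inE => /eqP->].
  have [//|p pl pmax] := IH.
  have [le|lt] := leqP (W a) (W p).
    exists p; first by rewrite in_cons pl orbT.
    by move=> q; rewrite in_cons => /orP[/eqP->//|/pmax].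
  exists a; first exact: mem_head.
  move=> q; rewrite in_cons => /orP[/eqP->//|/pmax h].
  exact: leq_trans h (ltnW lt).
move: F0 => /(congr1 (mcoeff (img_lead p.2 p.1))); rewrite mcoeff0.
have -> : \sum_i (F 0 i \mPo x) * y i =
    \sum_(q <- s) (F 0 q.1)@_q.2 *: (('X_[q.2] \mPo x) * y q.1).
  rewrite big_allpairs_dep /= big_enum /=; apply: eq_bigr => i _.
  rewrite {1}[F 0 i]mpolyE raddf_sum mulr_suml; apply: eq_bigr => m _ /=.
  by rewrite comp_mpolyZ scalerAl.
rewrite raddf_sum (bigD1_seq p) //=; last first.
  apply: allpairs_uniq_dep; rewrite ?enum_uniq //.
  by case=> a b [c d] _ _ [-> ->].
rewrite mcoeffZ (leads_coef (@leads_img p.2 p.1)) // eqxx mulr1 big_seq_cond big1.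
  move=> /eqP; rewrite addr0 mcoeff_eq0.
  by move: ps; rewrite memS /P => ->.
move=> q /andP[qs qp]; rewrite mcoeffZ (leads_coef (@leads_img q.2 q.1)); last exact: pmax.
case: eqP => [e|]; last by rewrite mulr0.
case: p q ps qs qp e {pmax} => i m [i' m'] /=.
rewrite !memS /P /= => hm hm' ne e.
have [em ei] := inj (nF _ _ hm) (nF _ _ hm') e.
by rewrite em ei eqxx in ne.
Qed.

End Independence.

(** * Rewriting rules on monomials given by lists of variables *)

Section Monomials.
Variables (K : fieldType) (n : nat).

(** Lists of variables, with repetition, make weights and divisibility computable. *)
Definition mon (s : seq nat) : 'X_{1..n.+1} := (\sum_(j <- s) U_(inord j))%MM.

Lemma mon_cons j s : mon (j :: s) = (U_(inord j) + mon s)%MM.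
Proof. by rewrite /mon big_cons. Qed.

Lemma mpolyX_nil : 'X_[mon [::]] = 1 :> {mpoly K[n.+1]}.
Proof. by rewrite /mon big_nil mpolyX0. Qed.

Lemma mpolyX_cons j s :
  'X_[mon (j :: s)] = 'X_(inord j) * 'X_[mon s] :> {mpoly K[n.+1]}.
Proof. by rewrite mon_cons mpolyXD. Qed.

Definition mpolyXE := (mpolyX_cons, mpolyX_nil).

Definition in_range (s : seq nat) := all (fun j => (j < n.+1)%N) s.

Lemma monE s t : in_range s -> (t < n.+1)%N -> mon s (inord t) = count_mem t s.
Proof.
move=> hs ht; elim: s hs => [|j s IH] /=; first by rewrite /mon big_nil mnm0E.
move=> /andP[hj /IH <-]; rewrite mon_cons mnmDE mnm1E -val_eqE /=.
by rewrite !inordK.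
Qed.

Lemma mon_lep s m : in_range s ->
  (mon s <= m)%MM = all (fun t => (count_mem t s <= m (inord t))%N) s.
Proof.
move=> hs; apply/mnm_lepP/allP => [h t ts|h i].
  by rewrite -monE // (allP hs).
rewrite -[ i ]inord_val monE //.
have [/h//|ni] := boolP ((i : nat) \in s).
by have /count_memPn-> := ni.
Qed.

Lemma sum_inord (R : nmodType) (F : 'I_n.+1 -> R) :
  \sum_j F j = \sum_(j <- iota 0 n.+1) F (inord j).
Proof.
transitivity (\sum_(j < n.+1) F (inord j)).
  by apply: eq_bigr => j _; rewrite inord_val.
by rewrite -(big_mkord xpredT (fun j => F (inord j))) /index_iota subn0.
Qed.

Lemma mnm_inordP (m m' : 'X_{1..n.+1}) :
  (forall t, (t < n.+1)%N -> m (inord t) = m' (inord t)) -> m = m'.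
Proof. by move=> h; apply/mnmP => i; rewrite -[ i ]inord_val; exact: h. Qed.

Definition seqwt (w s : seq nat) : nat := sumn [seq nth 0%N w j | j <- s].
Definition weights (w : seq nat) (i : 'I_n.+1) : nat := nth 0%N w i.

Lemma wgt_mon w s : in_range s -> wgt (weights w) (mon s) = seqwt w s.
Proof.
elim: s => [|j s IH] /=.
  by rewrite /mon big_nil /wgt big1 // => i _; rewrite mnm0E.
move=> /andP[hj /IH IHs]; rewrite mon_cons wgtD IHs /seqwt /=; congr (_ + _)%N.
rewrite /wgt (bigD1 (inord j)) //= mnm1E eqxx mul1n big1 ?addn0.
  by rewrite /weights inordK.
by move=> i /negbTE; rewrite mnm1E eq_sym => ->.
Qed.

Definition seqpoly (l : seq (int * seq nat)) : {mpoly K[n.+1]} :=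
  \sum_(t <- l) (t.1%:~R : K) *: 'X_[mon t.2].

Lemma leads_seq w s l (f : {mpoly K[n.+1]}) : in_range s ->
  all (fun t => in_range t.2 && (seqwt w t.2 < seqwt w s)%N) l ->
  f = 'X_[mon s] + seqpoly l -> leads (weights w) f (mon s).
Proof.
move=> hs /allP hl ->; rewrite /leads addrAC subrr add0r.
apply: below_sum => t /hl/andP[ht lt]; apply/belowZ/belowX.
by rewrite !wgt_mon.
Qed.

Lemma seqpoly_nil : seqpoly [::] = 0.
Proof. by rewrite /seqpoly big_nil. Qed.

Lemma seqpoly_cons t l : seqpoly (t :: l) = t.1%:~R * 'X_[mon t.2] + seqpoly l.
Proof. by rewrite /seqpoly big_cons -mul_mpolyC rmorph_int. Qed.

Definition seqpolyE := (seqpoly_cons, seqpoly_nil).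

End Monomials.

Section Rules.
Variables (K : fieldType) (n k : nat).
Local Notation vec := 'rV[{mpoly K[n.+1]}]_k.+1.

(** A monomial of the [k.+1]-tuples: the list of its variables and its position. *)
Definition term (t : seq nat * nat) : vec :=
  'X_[mon n t.1] *: delta_mx 0 (inord t.2).

(** A monomial and the combination of lighter monomials that replaces it. *)
Definition rule : Type := (seq nat * nat) * seq (int * (seq nat * nat)).

Definition tail (r : rule) : vec :=
  \sum_(t <- r.2) (t.1%:~R : {mpoly K[n.+1]}) *: term t.2.

Variables (w v : seq nat) (rules : seq rule).

Definition termwt (t : seq nat * nat) : nat := (seqwt w t.1 + nth 0%N v t.2)%N.

Definition term_ok (t : seq nat * nat) := in_range n t.1 && (t.2 < k.+1)%N.

Definition rule_ok (r : rule) : bool := term_ok r.1 &&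
  all (fun t => term_ok t.2 && (termwt t.2 < termwt r.1)%N) r.2.

Definition irreducible (m : 'X_{1..n.+1}) (i : 'I_k.+1) : bool :=
  all (fun r => ~~ ((r.1.2 == i :> nat) && (mon n r.1.1 <= m)%MM)) rules.

Variable U : vec -> Prop.
Hypotheses (U0 : U 0) (UD : forall F G, U F -> U G -> U (F + G)).
Hypothesis UZ : forall (c : {mpoly K[n.+1]}) F, U F -> U (c *: F).
Hypothesis rules_ok : all rule_ok rules.
Hypothesis rulesU : forall r, r \in rules -> U (term r.1 - tail r).

(** Divisibility by the head of a rule extends the rule to all multiples of it. *)
Lemma rules_normal_form (F : vec) :
  exists2 G, U (F - G) & normal_vec irreducible G.
Proof.
apply: (@normal_form _ _ _ (weights w) (weights v)) => // m i.
move=> /allPn[r hr]; rewrite negbK => /andP[/eqP ei le].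
have /andP[/andP[hs1 hs2] /allP ht] := allP rules_ok r hr.
exists ('X_[m - mon n r.1.1] *: tail r).
  have -> : 'X_[m] *: delta_mx 0 i = 'X_[m - mon n r.1.1] *: term r.1 :> vec.
    by rewrite /term scalerA -mpolyXD submK // ei inord_val.
  by rewrite -scalerBr; apply/UZ/rulesU.
have hw : (wgt (weights w) m + weights v i =
    wgt (weights w) (m - mon n r.1.1) + termwt r.1)%N.
  rewrite -[in LHS](submK le) wgtD -addnA; congr (_ + _)%N.
  by rewrite wgt_mon // /termwt ei.
rewrite hw /tail scaler_sumr big_seq; elim/big_ind: _.
- exact: vbelow0.
- exact: vbelowD.
move=> t /ht /andP[/andP[t1 t2] lt]; rewrite /term !scalerA.
apply: vbelow_delta => m'; rewrite mulrAC mulrC -mpolyXD.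
rewrite -(rmorph_int (@mpolyC n.+1 K)) mul_mpolyC => /msuppZ_le.
rewrite msuppX inE => /eqP->; rewrite wgtD -addnA ltn_add2l.
by rewrite wgt_mon // /weights inordK.
Qed.

End Rules.

Section ImageLeads.
Variables (n k r : nat) (mu nu : seq (seq nat)).
Hypotheses (mu_ok : all (in_range r) mu) (nu_ok : all (in_range r) nu).

Definition mu_of (j : 'I_n.+1) : 'X_{1..r.+1} := mon r (nth [::] mu j).
Definition nu_of (i : 'I_k.+1) : 'X_{1..r.+1} := mon r (nth [::] nu i).

Lemma img_leadE (m : 'X_{1..n.+1}) (i : 'I_k.+1) t : (t < r.+1)%N ->
  img_lead mu_of nu_of m i (inord t) =
  (\sum_(j <- iota 0 n.+1) count_mem t (nth [::] mu j) * m (inord j) +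
   count_mem t (nth [::] nu i))%N.
Proof.
have rg (s : seq (seq nat)) j : all (in_range r) s -> in_range r (nth [::] s j).
  move=> hs; have [lt|le] := ltnP j (size s); last by rewrite nth_default.
  by rewrite (allP hs) // mem_nth.
move=> ht; rewrite /img_lead mnmDE /nu_of monE ?rg //; congr (_ + _)%N.
rewrite mnm_sumE sum_inord big_seq [RHS]big_seq; apply: eq_bigr => j.
rewrite mem_iota /= => hj.
by rewrite mulmnE /mu_of monE ?rg // inordK.
Qed.

End ImageLeads.

(** * The quadrics of S J S and the chart of Lagrangian graphs *)

Section Quadrics.
Variable R : comNzRingType.
Implicit Types (x t z : nat -> R) (p q : R).

(** The entries (1,2), (1,3), (1,4), (2,3), (2,4), (3,4) of S J S, where [p i j]
    stands for the product of the variables i and j, and the variables a11, a12,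
    a22, b11, b12, b21, b22, d11, d12, d22 of S = [[a, b], [b^T, d]] are numbered
    from 0 to 9. *)
Definition quad (p : nat -> nat -> R) (k : nat) : R :=
  match k with
  | 0%N => p 0%N 5%N + p 1%N 6%N - p 1%N 3%N - p 2%N 4%N
  | 1%N => p 0%N 7%N + p 1%N 8%N - p 3%N 3%N - p 4%N 5%N
  | 2%N => p 0%N 8%N + p 1%N 9%N - p 3%N 4%N - p 4%N 6%N
  | 3%N => p 1%N 7%N + p 2%N 8%N - p 3%N 5%N - p 5%N 6%N
  | 4%N => p 1%N 8%N + p 2%N 9%N - p 4%N 5%N - p 6%N 6%N
  | 5%N => p 3%N 8%N + p 5%N 9%N - p 4%N 7%N - p 6%N 8%N
  | _ => 0
  end.

Definition sqz x : nat -> R := quad (fun i j => x i * x j).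

(** T J S + S J T, the derivative of S J S in the direction T. *)
Definition dsqz x t : nat -> R := quad (fun i j => x i * t j + t i * x j).

(** The entries of J in the positions of [quad]. *)
Definition jvec (k : nat) : R := ((k == 1) || (k == 4))%N%:R.

(** The ideal generated by the quadrics. *)
Definition sqz_span x (p : R) : Prop :=
  exists c : nat -> R, p = \sum_(k < 6) c k * sqz x k.

Lemma sqz_span0 x : sqz_span x 0.
Proof. by exists (fun=> 0); rewrite big1 // => k _; rewrite mul0r. Qed.

Lemma sqz_spanD x p q : sqz_span x p -> sqz_span x q -> sqz_span x (p + q).
Proof.
move=> [c ->] [d ->]; exists (fun k => c k + d k).
by rewrite -big_split; apply: eq_bigr => k _; rewrite mulrDl.
Qed.

Lemma sqz_spanM x a p : sqz_span x p -> sqz_span x (a * p).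
Proof.
move=> [c ->]; exists (fun k => a * c k).
by rewrite mulr_sumr; apply: eq_bigr => k _; rewrite mulrA.
Qed.

Lemma sqz_spanN x p : sqz_span x p -> sqz_span x (- p).
Proof. by move=> h; rewrite -mulN1r; exact: sqz_spanM. Qed.

Lemma sqz_spanB x p q : sqz_span x p -> sqz_span x q -> sqz_span x (p - q).
Proof. by move=> hp /sqz_spanN; exact: sqz_spanD. Qed.

Lemma sqz_span_gen x k : sqz_span x (sqz x k).
Proof.
have [lt|le] := ltnP k 6; last first.
  rewrite (_ : sqz x k = 0); first exact: sqz_span0.
  by case: k le => [|[|[|[|[|[|k]]]]]].
exists (fun j => (j == k)%:R); rewrite (bigD1 (Ordinal lt)) //= eqxx mul1r big1 ?addr0 //.
by move=> i /negbTE; rewrite -val_eqE /= => ->; rewrite mul0r.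
Qed.

(** S = (1, c)^T a (1, c), for the coordinates a11, a12, a22, c11, c12, c22.
    These are the matrices whose image lies in the Lagrangian graph of c. *)
Definition chart z (j : nat) : R :=
  let b11 := z 0%N * z 3%N + z 1%N * z 4%N in
  let b12 := z 0%N * z 4%N + z 1%N * z 5%N in
  let b21 := z 1%N * z 3%N + z 2%N * z 4%N in
  let b22 := z 1%N * z 4%N + z 2%N * z 5%N in
  match j with
  | 0%N => z 0%N | 1%N => z 1%N | 2%N => z 2%N
  | 3%N => b11 | 4%N => b12 | 5%N => b21 | 6%N => b22
  | 7%N => z 3%N * b11 + z 4%N * b21
  | 8%N => z 3%N * b12 + z 4%N * b22
  | 9%N => z 4%N * b12 + z 5%N * b22
  | _ => 0
  end.

Lemma sqz_chart z k : sqz (chart z) k = 0.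
Proof.
case: k => [|[|[|[|[|[|k]]]]]] //; rewrite /sqz /quad /chart /=; ring.
Qed.

End Quadrics.

Section Gens.
Variable K : fieldType.

Definition gen (n j : nat) : {mpoly K[n.+1]} := 'X_(inord j).

Definition subst_gen (n : nat) (f : nat -> {mpoly K[n.+1]}) (p : {mpoly K[10]}) :
  {mpoly K[n.+1]} := p \mPo [tuple f j | j < 10].

HB.instance Definition _ n f := GRing.RMorphism.copy (@subst_gen n f)
  (comp_mpoly [tuple f j | j < 10]).

Lemma subst_genE n f j : (j < 10)%N -> @subst_gen n f (gen 9 j) = f j.
Proof.
by move=> h; rewrite /subst_gen /gen comp_mpolyXU -tnth_nth tnth_mktuple inordK.
Qed.

Lemma quad_morph (R S : comNzRingType) (h : {additive R -> S}) p k :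
  h (quad p k) = quad (fun i j => h (p i j)) k.
Proof.
by case: k => [|[|[|[|[|[|k]]]]]] /=; rewrite ?raddf0 // !(raddfB, raddfD).
Qed.

Lemma eq_quad (R : comNzRingType) (p q : nat -> nat -> R) k :
  (forall i j, (i < 10)%N -> (j < 10)%N -> p i j = q i j) -> quad p k = quad q k.
Proof. by move=> h; case: k => [|[|[|[|[|[|k]]]]]] //=; rewrite !h. Qed.

Lemma subst_gen_sqz n f k : @subst_gen n f (sqz (gen 9) k) = sqz f k.
Proof.
rewrite quad_morph; apply: eq_quad => i j hi hj.
by rewrite [LHS]rmorphM /= !subst_genE.
Qed.

Lemma sqz_span_subst n f (p : {mpoly K[10]}) : (forall k, sqz f k = 0) ->
  sqz_span (gen 9) p -> @subst_gen n f p = 0.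
Proof.
move=> h [c ->]; rewrite rmorph_sum big1 // => k _ /=.
by rewrite rmorphM /= subst_gen_sqz h mulr0.
Qed.

Definition chart_hom := subst_gen (chart (gen 5)).

HB.instance Definition _ := GRing.RMorphism.copy chart_hom
  (subst_gen (chart (gen 5))).

Definition var_lead : seq (seq nat) :=
  [:: [:: 0]; [:: 1]; [:: 2]; [:: 0; 3]; [:: 0; 4]; [:: 2; 4]; [:: 2; 5];
      [:: 0; 3; 3]; [:: 0; 3; 4]; [:: 2; 5; 5]]%N.

(** For this weight each of the ten coordinates of the chart has a single
    heaviest monomial. *)
Definition chart_wt : seq nat := [:: 3; 0; 2; 1; 0; 1]%N.

Lemma chart_leads (j : 'I_10) :
  leads (weights chart_wt) (tnth [tuple chart (gen 5) j | j < 10] j)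
    (mu_of 5 var_lead j).
Proof.
rewrite tnth_mktuple /mu_of.
pose rest : seq (seq (int * seq nat)) := [:: [::]; [::]; [::];
  [:: (1%Z, [:: 1; 4])]; [:: (1%Z, [:: 1; 5])]; [:: (1%Z, [:: 1; 3])];
  [:: (1%Z, [:: 1; 4])]; [:: (2%Z, [:: 1; 3; 4]); (1%Z, [:: 2; 4; 4])];
  [:: (1%Z, [:: 1; 3; 5]); (1%Z, [:: 1; 4; 4]); (1%Z, [:: 2; 4; 5])];
  [:: (1%Z, [:: 0; 4; 4]); (2%Z, [:: 1; 4; 5])]]%N.
case: j => j hj; apply: (@leads_seq _ _ _ _ (nth [::] rest j)).
- by do 10 (case: j hj => [|j] hj //).
- by do 10 (case: j hj => [|j] hj //).
do 10 (case: j hj => [|j] hj;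
  first by rewrite /chart /= !seqpolyE /= !mpolyXE /gen; ring).
by [].
Qed.

End Gens.
Arguments gen {K} n j.

(** * The coordinate ring embeds in the chart *)

Section Kernels.
Variable K : fieldType.
Local Notation S := {mpoly K[10]}.
Local Notation X := (@gen K 9).

(** The six quadrics solved for their leading monomials, in the position [i]. *)
Definition sqz_rules (i : nat) : seq rule :=
  [:: (([:: 0; 5], i), [:: ((-1)%Z, ([:: 1; 6], i)); (1%Z, ([:: 1; 3], i)); (1%Z, ([:: 2; 4], i))]);
      (([:: 3; 3], i), [:: (1%Z, ([:: 0; 7], i)); (1%Z, ([:: 1; 8], i)); ((-1)%Z, ([:: 4; 5], i))]);
      (([:: 3; 4], i), [:: (1%Z, ([:: 0; 8], i)); (1%Z, ([:: 1; 9], i)); ((-1)%Z, ([:: 4; 6], i))]);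
      (([:: 3; 5], i), [:: (1%Z, ([:: 1; 7], i)); (1%Z, ([:: 2; 8], i)); ((-1)%Z, ([:: 5; 6], i))]);
      (([:: 6; 6], i), [:: (1%Z, ([:: 1; 8], i)); (1%Z, ([:: 2; 9], i)); ((-1)%Z, ([:: 4; 5], i))]);
      (([:: 4; 7], i), [:: (1%Z, ([:: 3; 8], i)); (1%Z, ([:: 5; 9], i)); ((-1)%Z, ([:: 6; 8], i))])]%N.

Definition sqz_wt : seq nat := [:: 6; 3; 3; 7; 3; 5; 6; 5; 0; 2]%N.

Lemma tail_entry n k (r : rule) (i : 'I_k.+1) : tail K n k r 0 i =
  \sum_(t <- r.2) (t.1%:~R : {mpoly K[n.+1]}) * ('X_[mon n t.2.1] * (i == inord t.2.2)%:R).
Proof.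
by rewrite /tail summxE; apply: eq_bigr => t _; rewrite !mxE eqxx.
Qed.

Lemma term_entry n k t (i : 'I_k.+1) :
  term K n k t 0 i = 'X_[mon n t.1] * (i == inord t.2)%:R.
Proof. by rewrite !mxE eqxx. Qed.

Lemma in_cons_all (T : eqType) (P : T -> Prop) x s :
  P x -> (forall y, y \in s -> P y) -> forall y, y \in x :: s -> P y.
Proof. by move=> Px Ps y; rewrite inE => /orP[/eqP->|/Ps]. Qed.

Lemma sqz_rulesE k (i : nat) r (j : 'I_k.+1) : r \in sqz_rules i ->
  sqz_span X ((term K 9 k r.1 - tail K 9 k r) 0 j).
Proof.
move: r; pose e : S := (j == inord i)%:R.
have P (r : rule) q a : 'X_[mon 9 r.1.1] * (j == inord r.1.2)%:R -
    \sum_(t <- r.2) (t.1%:~R : S) * ('X_[mon 9 t.2.1] * (j == inord t.2.2)%:R) =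
    a * sqz X q -> sqz_span X ((term K 9 k r.1 - tail K 9 k r) 0 j).
  move=> E; rewrite mxE [X in _ + X]mxE term_entry tail_entry E.
  exact/sqz_spanM/sqz_span_gen.
apply: in_cons_all; first apply: (P _ 0%N e).
  by rewrite /= !big_cons big_nil -/e !mpolyXE /sqz /= /gen; ring.
apply: in_cons_all; first apply: (P _ 1%N (- e)).
  by rewrite /= !big_cons big_nil -/e !mpolyXE /sqz /= /gen; ring.
apply: in_cons_all; first apply: (P _ 2%N (- e)).
  by rewrite /= !big_cons big_nil -/e !mpolyXE /sqz /= /gen; ring.
apply: in_cons_all; first apply: (P _ 3%N (- e)).
  by rewrite /= !big_cons big_nil -/e !mpolyXE /sqz /= /gen; ring.
apply: in_cons_all; first apply: (P _ 4%N (- e)).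
  by rewrite /= !big_cons big_nil -/e !mpolyXE /sqz /= /gen; ring.
apply: in_cons_all; first apply: (P _ 5%N (- e)).
  by rewrite /= !big_cons big_nil -/e !mpolyXE /sqz /= /gen; ring.
by [].
Qed.

(** The exponents of the image of a normal monomial determine it, because a normal
    monomial contains b22 at most once, b11 at most once and never together with
    b12 or b21, and neither a11 b21 nor b12 d11. *)
Lemma sqz_lead_inj (m : 'X_{1..10}) (i : 'I_1) (m' : 'X_{1..10}) (i' : 'I_1) :
  irreducible (sqz_rules 0) m i -> irreducible (sqz_rules 0) m' i' ->
  img_lead (mu_of 5 var_lead) (nu_of 5 [:: [::]]) m i =
  img_lead (mu_of 5 var_lead) (nu_of 5 [:: [::]]) m' i' -> m = m' /\ i = i'.
Proof.
rewrite (ord1 i) (ord1 i') => nm nm' e; split=> //.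
have E t : (t < 6)%N -> _ := fun ht => congr1 (fun f : 'X_{1..6} => f (inord t)) e.
move: (E 0%N isT) (E 1%N isT) (E 2%N isT) (E 3%N isT) (E 4%N isT) (E 5%N isT).
rewrite !img_leadE // /= !big_cons !big_nil /= ?(addn0, add0n, mul0n, mul1n).
move: nm nm'; rewrite /irreducible /= !mon_lep //= ?(addn0, add0n) => nm nm' *.
apply: mnm_inordP => t ht; do 10 (case: t ht => [|t] ht; first by lia).
by [].
Qed.

(** A has no torsion along the complement of the chart: normal monomials stay
    independent in the chart. *)
Lemma chart_kernel (p : S) : chart_hom p = 0 -> sqz_span X p.
Proof.
move=> p0; pose U (F : 'rV[S]_1) := forall j, sqz_span X (F 0 j).
have [| | | | |G UG nG] := @rules_normal_form K 9 0 sqz_wt [::] (sqz_rules 0) U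
  _ _ _ _ _ (const_mx p).
- by move=> j; rewrite mxE; exact: sqz_span0.
- by move=> F G UF UG j; rewrite mxE; exact: sqz_spanD.
- by move=> c F UF j; rewrite mxE; exact: sqz_spanM.
- by [].
- by move=> r hr j; apply: (sqz_rulesE (i := 0)).
suff G0 : G = 0 by have := UG 0; rewrite G0 subr0 mxE.
apply: (normal_inj (y := fun=> 1) (@chart_leads K) _ sqz_lead_inj) => //.
  by move=> i; rewrite ord1 /nu_of /= /mon big_nil; exact: leads1.
rewrite big_ord1 mulr1; have := UG 0; rewrite !mxE.
move=> /(sqz_span_subst (sqz_chart (gen 5))).
by rewrite rmorphB /= -[subst_gen _ p]/(chart_hom p) p0 sub0r => /eqP; rewrite oppr_eq0 => /eqP.
Qed.

Lemma chart_sqz_span (p : S) : sqz_span X p -> chart_hom p = 0.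
Proof. exact/sqz_span_subst/sqz_chart. Qed.

End Kernels.

(** * Syzygies over the coordinate ring *)

Section Syzygies.
Variable K : fieldType.
Hypothesis two_neq0 : 2%:R != 0 :> K.
Local Notation S := {mpoly K[10]}.
Local Notation X := (@gen K 9).

(** The ten vectors [dsqz X t] for constant [t], written in the positions of
    [syz_val] and solved for their leading monomials. *)
Definition syz_rules : seq rule :=
  [:: (([:: 1], 2), [:: (1%Z, ([:: 0], 3))]);
      (([:: 0], 1), [:: (1%Z, ([:: 2], 2))]);
      (([:: 1], 1), [:: (1%Z, ([:: 2], 3))]);
      (([:: 0], 0), [:: (1%Z, ([:: 3], 2)); (1%Z, ([:: 6], 2))]);
      (([:: 2], 0), [:: (1%Z, ([:: 6], 1)); (1%Z, ([:: 3], 1))]);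
      (([:: 1], 0), [:: ((-1)%Z, ([:: 4], 1)); (1%Z, ([:: 5], 2)); (2%Z, ([:: 6], 3))]);
      (([:: 3], 0), [:: (1%Z, ([:: 6], 0)); ((-1)%Z, ([:: 9], 1)); (1%Z, ([:: 7], 2))]);
      (([:: 4], 0), [:: (1%Z, ([:: 8], 2)); (1%Z, ([:: 9], 3))]);
      (([:: 5], 0), [:: (1%Z, ([:: 8], 1)); (1%Z, ([:: 7], 3))]);
      (([:: 5], 2), [:: (1%Z, ([:: 4], 1)); (1%Z, ([:: 3], 3)); ((-1)%Z, ([:: 6], 3))])]%N.

Definition all_rules : seq rule :=
  syz_rules ++ sqz_rules 0 ++ sqz_rules 1 ++ sqz_rules 2 ++ sqz_rules 3.

Definition syz_wt : seq nat := [:: 10; 4; 6; 0]%N.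

Definition unit_at (j : nat) (c : S) : nat -> S := fun k => if k == j then c else 0.

(** The entries (1,2), (1,4), (2,3) and (1,3) - (2,4) of T J S + S J T modulo the
    quadrics.  The signs of the second and the last are changed, so that the
    syzygies are those of the elements of [syz_val]. *)
Definition syz_span (F : 'rV[S]_4) : Prop := exists t : nat -> S,
  [/\ sqz_span X (F 0 (inord 0) - dsqz X t 0), sqz_span X (F 0 (inord 1) + dsqz X t 2),
      sqz_span X (F 0 (inord 2) - dsqz X t 3) &
      sqz_span X (F 0 (inord 3) + dsqz X t 1 - dsqz X t 4)].

Lemma dsqzD (R : comNzRingType) (x t u : nat -> R) k :
  dsqz x (fun j => t j + u j) k = dsqz x t k + dsqz x u k.
Proof. by case: k => [|[|[|[|[|[|k]]]]]]; rewrite /dsqz /quad ?addr0 //; ring. Qed.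

Lemma dsqzZ (R : comNzRingType) (x t : nat -> R) c k :
  dsqz x (fun j => c * t j) k = c * dsqz x t k.
Proof. by case: k => [|[|[|[|[|[|k]]]]]]; rewrite /dsqz /quad ?mulr0 //; ring. Qed.

Lemma dsqz0 (R : comNzRingType) (x : nat -> R) k : dsqz x (fun=> 0) k = 0.
Proof. by case: k => [|[|[|[|[|[|k]]]]]]; rewrite /dsqz /quad //; ring. Qed.

Lemma syz_span0 (F : 'rV[S]_4) : (forall i, sqz_span X (F 0 i)) -> syz_span F.
Proof.
by move=> h; exists (fun=> 0); rewrite !dsqz0 !(subr0, addr0); split.
Qed.

Lemma syz_spanD F G : syz_span F -> syz_span G -> syz_span (F + G).
Proof.
move=> [t [t0 t1 t2 t3]] [u [u0 u1 u2 u3]]; exists (fun j => t j + u j).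
rewrite !mxE !dsqzD; split.
- by rewrite opprD addrACA; exact: sqz_spanD.
- by rewrite addrACA; exact: sqz_spanD.
- by rewrite opprD addrACA; exact: sqz_spanD.
- have := sqz_spanD t3 u3; congr (sqz_span _ _); ring.
Qed.

Lemma syz_spanZ c F : syz_span F -> syz_span (c *: F).
Proof.
move=> [t [t0 t1 t2 t3]]; exists (fun j => c * t j).
by rewrite !mxE !dsqzZ -!mulrBr -!mulrDr -!mulrBr; split; exact: sqz_spanM.
Qed.

Lemma inord_eq n a b : (a < n.+1)%N -> (b < n.+1)%N ->
  ((inord a : 'I_n.+1) == inord b) = (a == b).
Proof. by move=> ha hb; rewrite -val_eqE /= !inordK. Qed.

Lemma syz_rule_span (r : rule) t :
  term K 9 3 r.1 0 (inord 0) - tail K 9 3 r 0 (inord 0) = dsqz X t 0 ->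
  term K 9 3 r.1 0 (inord 1) - tail K 9 3 r 0 (inord 1) = - dsqz X t 2 ->
  term K 9 3 r.1 0 (inord 2) - tail K 9 3 r 0 (inord 2) = dsqz X t 3 ->
  term K 9 3 r.1 0 (inord 3) - tail K 9 3 r 0 (inord 3) = dsqz X t 4 - dsqz X t 1 ->
  syz_span (term K 9 3 r.1 - tail K 9 3 r).
Proof.
move=> e0 e1 e2 e3; exists t.
have E i : (term K 9 3 r.1 - tail K 9 3 r) 0 i = term K 9 3 r.1 0 i - tail K 9 3 r 0 i.
  by rewrite mxE [X in _ + X]mxE.
rewrite !E e0 e1 e2 e3 !subrr addNr subrK subrr.
by split; exact: sqz_span0.
Qed.

Lemma syz_rulesE r : r \in syz_rules -> syz_span (term K 9 3 r.1 - tail K 9 3 r).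
Proof.
move: r; do 10 (apply: in_cons_all; first shelve); by [].
Unshelve.
(* the fields in the directions d11, d12, d22, b21, b12, b22, a12, a22, a11, up
   to sign, and minus half of the sum of those in the directions b11 and b22 *)
all: [> apply: (@syz_rule_span _ (unit_at 7 1))
      | apply: (@syz_rule_span _ (unit_at 8 (-1)))
      | apply: (@syz_rule_span _ (unit_at 9 (-1)))
      | apply: (@syz_rule_span _ (unit_at 5 1))
      | apply: (@syz_rule_span _ (unit_at 4 (-1)))
      | apply: (@syz_rule_span _ (unit_at 6 1))
      | apply: (@syz_rule_span _ (unit_at 1 (-1)))
      | apply: (@syz_rule_span _ (unit_at 2 (-1)))
      | apply: (@syz_rule_span _ (unit_at 0 1))
      | apply: (@syz_rule_span _
          (fun j => unit_at 3 (- (2%:R^-1)%:MP) j + unit_at 6 (- (2%:R^-1)%:MP) j)) ].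
all: rewrite term_entry tail_entry /= !big_cons big_nil /= !inord_eq //=.
all: rewrite /dsqz /quad /unit_at /= !mpolyXE /gen; try ring.
all: have h2 : (2%:R^-1)%:MP + (2%:R^-1)%:MP = 1 :> S
  by rewrite -mpolyCD -mulr2n -[_ *+ 2]mulr_natr mulVf // mpolyC1.
all: move: h2; set h := mpolyC _ _ => h2.
all: by rewrite -[LHS]mul1r -{1}h2; ring.
Qed.

End Syzygies.

Section SyzLead.
Variable K : fieldType.
Definition syz_lead : seq (seq nat) := [:: [:: 0; 3]; [:: 2]; [:: 0]; [:: 1]]%N.

(** The elements b11 + b22, a22, a11, a12 of A, evaluated in the chart. *)
Definition syz_val (z : nat -> {mpoly K[6]}) (i : nat) : {mpoly K[6]} :=
  match i with
  | 0%N => chart z 3 + chart z 6 | 1%N => chart z 2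
  | 2%N => chart z 0 | _ => chart z 1
  end.

Lemma syz_val_leads (i : 'I_4) :
  leads (weights chart_wt) (syz_val (gen 5) i) (nu_of 5 syz_lead i).
Proof.
rewrite /nu_of; pose rest : seq (seq (int * seq nat)) :=
  [:: [:: (1%Z, [:: 2; 5]); (2%Z, [:: 1; 4])]; [::]; [::]; [::]]%N.
case: i => j hj; apply: (@leads_seq _ _ _ _ (nth [::] rest j)).
- by do 4 (case: j hj => [|j] hj //).
- by do 4 (case: j hj => [|j] hj //).
do 4 (case: j hj => [|j] hj;
  first by rewrite /syz_val /chart /= !seqpolyE /= !mpolyXE /gen; ring).
by [].
Qed.

(** In position 0 only b22, d11, d12 and d22 survive in normal monomials, and in
    positions 1 and 2 the variable a12 does not, so that the four images do not
    overlap. *)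
Lemma syz_lead_inj (m : 'X_{1..10}) (i : 'I_4) (m' : 'X_{1..10}) (i' : 'I_4) :
  irreducible all_rules m i -> irreducible all_rules m' i' ->
  img_lead (mu_of 5 var_lead) (nu_of 5 syz_lead) m i =
  img_lead (mu_of 5 var_lead) (nu_of 5 syz_lead) m' i' -> m = m' /\ i = i'.
Proof.
move=> nm nm' e.
have E t : (t < 6)%N -> _ := fun ht => congr1 (fun f : 'X_{1..6} => f (inord t)) e.
move: (E 0%N isT) (E 1%N isT) (E 2%N isT) (E 3%N isT) (E 4%N isT) (E 5%N isT).
rewrite !img_leadE // /= !big_cons !big_nil /= ?(addn0, add0n, mul0n, mul1n).
move: nm nm'; rewrite /irreducible /= !mon_lep //= ?(addn0, add0n) {e E}.
case: i => i hi; case: i' => i' hi'.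
do 4 (case: i hi => [|i] hi /=;
  [do 4 (case: i' hi' => [|i'] hi' /=;
    [ (move=> nm nm' *; first
      [ exfalso; lia
      | split; [apply: mnm_inordP => t ht; do 10 (case: t ht => [|t] ht; first by lia); by []
               | exact: val_inj]])
    | ]); by []
  | ]); by [].
Qed.
End SyzLead.

(** * Homomorphisms from the conormal module, in coordinates *)

Section LinearSyzygies.
Variable R : comNzRingType.
Implicit Types (x t u z : nat -> R).

(** A linear syzygy: minus the entry (1,2) of S J U - U J S, which vanishes for
    U = S J S. *)
Definition lsyz1 x u : R :=
  u 0%N * (x 3%N + x 6%N) - u 2%N * x 2%N + u 3%N * x 0%N - (u 1%N - u 4%N) * x 1%N.

(** The entry (1,4) of S J U - U J S. *)
Definition lsyz2 x u : R :=
  (u 1%N - u 4%N) * x 4%N + u 2%N * (x 6%N - x 3%N) + u 5%N * x 0%N - u 0%N * x 9%N.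

Lemma lsyz1_sqz x : lsyz1 x (sqz x) = 0.
Proof. rewrite /lsyz1 /sqz /=; ring. Qed.

Lemma lsyz2_sqz x : lsyz2 x (sqz x) = 0.
Proof. rewrite /lsyz2 /sqz /=; ring. Qed.

(** Differentiation of the syzygy. *)
Lemma lsyz1_dsqz x t : lsyz1 x (dsqz x t) = - lsyz1 t (sqz x).
Proof. rewrite /lsyz1 /sqz /dsqz /=; ring. Qed.

Lemma lsyz2_dsqz x t : lsyz2 x (dsqz x t) = - lsyz2 t (sqz x).
Proof. rewrite /lsyz2 /sqz /dsqz /=; ring. Qed.

Lemma sqz_span_lsyz2 x t : sqz_span x (lsyz2 t (sqz x)).
Proof.
have g := sqz_span_gen x; have M a k : sqz_span x (sqz x k * a).
  by rewrite mulrC; exact: sqz_spanM.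
rewrite /lsyz2 mulrBl; apply: sqz_spanB => //; apply: sqz_spanD => //.
by apply: sqz_spanD => //; exact: sqz_spanB.
Qed.

End LinearSyzygies.

Section Structure.
Variable K : fieldType.
Hypothesis two_neq0 : 2%:R != 0 :> K.
Local Notation S := {mpoly K[10]}.
Local Notation X := (@gen K 9).
Local Notation chartX := (chart (@gen K 5)).

Lemma chart_hom_gen j : (j < 10)%N -> chart_hom (X j) = chartX j.
Proof. by move=> h; rewrite /chart_hom subst_genE. Qed.

Lemma subst_gen_dsqz n f (t : nat -> S) k :
  @subst_gen K n f (dsqz X t k) = dsqz f (fun j => subst_gen f (t j)) k.
Proof.
rewrite quad_morph; apply: eq_quad => i j hi hj.
by rewrite [LHS]rmorphD !rmorphM /= !subst_genE.
Qed.

Lemma chart_hom_dsqz (t : nat -> S) k :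
  chart_hom (dsqz X t k) = dsqz chartX (fun j => chart_hom (t j)) k.
Proof. exact: subst_gen_dsqz. Qed.

Definition syz_eval (F : 'rV[S]_4) : {mpoly K[6]} :=
  \sum_i chart_hom (F 0 i) * syz_val (gen 5) i.

Lemma syz_evalE F : syz_eval F =
  chart_hom (F 0 (inord 0)) * (chartX 3 + chartX 6) +
  chart_hom (F 0 (inord 1)) * chartX 2 + chart_hom (F 0 (inord 2)) * chartX 0 +
  chart_hom (F 0 (inord 3)) * chartX 1.
Proof.
rewrite /syz_eval (sum_inord (fun i : 'I_4 => chart_hom (F 0 i) * syz_val (gen 5) i)).
by rewrite !big_cons big_nil !inordK //= addr0 !addrA.
Qed.

Lemma syz_eval_span F : syz_span F -> syz_eval F = 0.
Proof.
move=> [t]; have hd k := chart_hom_dsqz t k.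
have : lsyz1 chartX (dsqz chartX (fun j => chart_hom (t j))) = 0.
  by rewrite lsyz1_dsqz /lsyz1 !sqz_chart; ring.
move: (dsqz X t) (dsqz chartX _) hd => d e hd e0 [t0 t1 t2 t3].
have E p q : sqz_span X (p - q) -> chart_hom p = chart_hom q.
  by move/chart_sqz_span/eqP; rewrite rmorphB subr_eq0 => /eqP.
rewrite syz_evalE (E _ _ t0) (E _ _ t2) (E (F 0 (inord 1)) (- d 2%N)) ?opprK //.
rewrite (E (F 0 (inord 3)) (d 4%N - d 1%N)); last first.
  by move: t3; congr (sqz_span _ _); ring.
by rewrite rmorphN rmorphB /= !hd -[RHS]e0 /lsyz1 /chart /=; ring.
Qed.

Lemma syz_kernel F : syz_eval F = 0 -> syz_span F.
Proof.
move=> F0.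
have [| | | | |G UG nG] := @rules_normal_form K 9 3 sqz_wt syz_wt all_rules
  (@syz_span K) _ _ _ _ _ F.
- by apply: syz_span0 => i; rewrite mxE; exact: sqz_span0.
- exact: syz_spanD.
- exact: syz_spanZ.
- by [].
- move=> r; rewrite !mem_cat => /orP[|h]; first exact: syz_rulesE.
  apply: syz_span0 => j.
  by case/or4P: h; apply: sqz_rulesE.
suff G0 : G = 0 by rewrite G0 subr0 in UG.
apply: (normal_inj (y := fun i : 'I_4 => syz_val (gen 5) i) (@chart_leads K) _
  syz_lead_inj) => //; first exact: syz_val_leads.
transitivity (syz_eval F - syz_eval (F - G)); last by rewrite F0 syz_eval_span ?subr0.
rewrite /syz_eval -sumrB; apply: eq_bigr => i _.
by rewrite -mulrBl -rmorphB !mxE /= opprB addrC subrK.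
Qed.

(** When the other entries vanish in A, the second syzygy is a11 times the last
    entry, and a11 is not a zero divisor. *)
Lemma lsyz2_last (v : nat -> S) : sqz_span X (v 0%N) -> sqz_span X (v 1%N) ->
  sqz_span X (v 2%N) -> sqz_span X (v 4%N) -> sqz_span X (lsyz2 X v) ->
  sqz_span X (v 5%N).
Proof.
move=> /chart_sqz_span v0 /chart_sqz_span v1 /chart_sqz_span v2 /chart_sqz_span v4.
move=> /chart_sqz_span; rewrite /lsyz2 !(rmorphB, rmorphD, rmorphM) /=.
rewrite v0 v1 v2 v4 !chart_hom_gen // !(mul0r, subr0, add0r) => /eqP.
rewrite mulf_eq0 => /orP[/eqP/chart_kernel//|].
by rewrite /chart /gen /= -msupp_eq0 msuppX.
Qed.

(** The multiple [f] of J is read off from the entry (2,4), which enters the linear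
    syzygies only through its difference with the entry (1,3). *)
Lemma linear_syzygies_split (u : nat -> S) :
  sqz_span X (lsyz1 X u) -> sqz_span X (lsyz2 X u) ->
  exists f t, forall k, (k < 6)%N -> sqz_span X (u k - f * jvec S k - dsqz X t k).
Proof.
move=> h1 h2.
pose F : 'rV[S]_4 := \row_(i < 4) nth 0 [:: u 0%N; - u 2%N; u 3%N; u 4%N - u 1%N] i.
have FE i : (i < 4)%N ->
    F 0 (inord i) = nth 0 [:: u 0%N; - u 2%N; u 3%N; u 4%N - u 1%N] i.
  by move=> hi; rewrite mxE inordK.
have [t [t0 t2 t3 t14]] : syz_span F.
  apply: syz_kernel; rewrite syz_evalE !FE //= -(chart_sqz_span h1) /lsyz1.
  by rewrite !(rmorphB, rmorphD, rmorphM, rmorphN) /= !chart_hom_gen // /chart /=; ring.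
move: t0 t2 t3 t14; rewrite !FE //= => t0 t2 t3 t14.
pose f := u 4%N - dsqz X t 4; exists f, t.
pose v k := u k - f * jvec S k - dsqz X t k.
have v0 : sqz_span X (v 0%N) by rewrite /v /jvec /= mulr0 subr0.
have v1 : sqz_span X (v 1%N).
  by have := sqz_spanN t14; congr (sqz_span _ _); rewrite /v /f /jvec /=; ring.
have v2 : sqz_span X (v 2%N).
  by have := sqz_spanN t2; congr (sqz_span _ _); rewrite /v /jvec /=; ring.
have v3 : sqz_span X (v 3%N) by rewrite /v /jvec /= mulr0 subr0.
have v4 : sqz_span X (v 4%N).
  by have := sqz_span0 X; congr (sqz_span _ _); rewrite /v /f /jvec /=; ring.
suff v5 : sqz_span X (v 5%N) by case=> [|[|[|[|[|[|k]]]]]].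
apply: lsyz2_last => //.
rewrite (_ : lsyz2 X v = lsyz2 X u - lsyz2 X (dsqz X t)); last first.
  by rewrite /lsyz2 /v /jvec /=; ring.
by apply: sqz_spanB => //; rewrite lsyz2_dsqz; apply/sqz_spanN/sqz_span_lsyz2.
Qed.

End Structure.

(** * Minors and rank one matrices *)

(** The number of the entry (a, b) of S among the ten variables. *)
Definition idx (a b : nat) : nat :=
  nth 0 (nth [::] [:: [:: 0; 1; 3; 4]; [:: 1; 2; 5; 6]; [:: 3; 5; 7; 8]; [:: 4; 6; 8; 9]] a) b.
Definition row_of (j : nat) : nat := nth 0 [:: 0; 0; 1; 0; 0; 1; 1; 2; 2; 3] j.
Definition col_of (j : nat) : nat := nth 0 [:: 0; 1; 1; 2; 3; 2; 3; 2; 3; 3] j.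

Section MinorField.
Variable R : comNzRingType.
Implicit Types (x t z : nat -> R).

(** The entries of J. *)
Definition symp (a b : nat) : R := (b == a + 2)%N%:R - (a == b + 2)%N%:R.

Definition minor x (p q r s : nat) : R :=
  x (idx p r) * x (idx q s) - x (idx p s) * x (idx q r).

(** A vector field T, linear in S, for which T J S + S J T is four times a minor
    times J modulo the quadrics.  Write Jp for the p-th column of J and uv for the
    symmetric product of two vectors.  The first part of T polarizes a multiple of
    S(p,p) Jq Jq - 2 S(p,q) Jp Jq + S(q,q) Jp Jp, and the other terms correct it
    when J(p,q) or J(r,s) is not zero. *)
Definition minor_field x (p q r s j : nat) : R :=
  let J := symp in let a := row_of j in let b := col_of j in
  let JJ u v := J a u * J b v + J a v * J b u in
  let SJ u v := x (idx a u) * J b v + J a v * x (idx b u) in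
  2%:R * (x (idx p r) * JJ q s - x (idx p s) * JJ q r
          - x (idx q r) * JJ p s + x (idx q s) * JJ p r)
  - J p q * (SJ r s - SJ s r) - J r s * (SJ p q - SJ q p).

(** The entries of x x^T. *)
Definition veronese z (j : nat) : R := z (row_of j) * z (col_of j).

Lemma sqz_veronese z k : sqz (veronese z) k = 0.
Proof.
case: k => [|[|[|[|[|[|k]]]]]] //; rewrite /sqz /quad /veronese /=; ring.
Qed.

(** At S = x x^T the matrix T J S + S J T has rank at most two, and this is its
    Pfaffian. *)
Lemma dsqz_veronese_pfaff z t : dsqz (veronese z) t 0 * dsqz (veronese z) t 5
  - dsqz (veronese z) t 1 * dsqz (veronese z) t 4 + dsqz (veronese z) t 2 * dsqz (veronese z) t 3 = 0.
Proof. rewrite /dsqz /quad /veronese /=; ring. Qed.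

(** The twenty independent minors, chosen so that x(p,r) x(q,s) is the leading
    product: squares and products of two off-diagonal entries in one row or
    column are reduced to diagonal entries, and disjoint pairs to a12 d12. *)
Definition minors : seq (nat * nat * nat * nat) :=
  [:: (0, 1, 1, 0); (0, 2, 2, 0); (0, 3, 3, 0); (1, 2, 2, 1); (1, 3, 3, 1); (2, 3, 3, 2);
      (0, 2, 1, 0); (0, 3, 1, 0); (0, 3, 2, 0); (1, 2, 0, 1); (1, 3, 0, 1); (1, 3, 2, 1);
      (2, 1, 0, 2); (2, 3, 0, 2); (2, 3, 1, 2); (3, 1, 0, 3); (3, 2, 0, 3); (3, 2, 1, 3);
      (0, 3, 2, 1); (0, 2, 3, 1)]%N.

Lemma minor_field_chart z u k : u \in minors -> (k < 6)%N ->
  let: (p, q, r, s) := u in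
  dsqz (chart z) (minor_field (chart z) p q r s) k =
  4%:R * (minor (chart z) p q r s * jvec R k).
Proof.
move=> hu hk; move: u hu.
do 20 (apply: in_cons_all; first (do 6 (case: k hk => [|k] hk;
  first by rewrite /dsqz /quad /minor /minor_field /symp /jvec /chart /=; ring); by [])).
by [].
Qed.

End MinorField.

Definition veronese_rules : seq rule :=
  [seq let: (p, q, r, s) := u in
    (([:: idx p r; idx q s], 0), [:: (1%Z, ([:: idx p s; idx q r], 0))]) | u <- minors]%N.

Definition veronese_wt : seq nat := [:: 0; 2; 0; 3; 3; 3; 3; 0; 2; 0]%N.

Definition veronese_lead : seq (seq nat) := [seq [:: row_of j; col_of j] | j <- iota 0 10].

Definition off_diagonal (m : 'X_{1..10}) : seq nat :=
  [:: m (inord 1); m (inord 3); m (inord 4); m (inord 5); m (inord 6); m (inord 8)].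

Definition off_diagonals : seq (seq nat) :=
  [:: [:: 0; 0; 0; 0; 0; 0]; [:: 1; 0; 0; 0; 0; 0]; [:: 0; 1; 0; 0; 0; 0];
      [:: 0; 0; 1; 0; 0; 0]; [:: 0; 0; 0; 1; 0; 0]; [:: 0; 0; 0; 0; 1; 0];
      [:: 0; 0; 0; 0; 0; 1]; [:: 1; 0; 0; 0; 0; 1]]%N.

(** At most one off-diagonal entry, or the product a12 d12. *)
Lemma irreducible_off_diagonal m : irreducible veronese_rules m (0 : 'I_1) ->
  off_diagonal m \in off_diagonals.
Proof.
rewrite /irreducible /= !mon_lep //= ?(addn0, add0n) /off_diagonal.
move: (m (inord 1)) (m (inord 3)) (m (inord 4)) (m (inord 5)) (m (inord 6)) (m (inord 8)).
by move=> [|[|?]] [|[|?]] [|[|?]] [|[|?]] [|[|?]] [|[|?]].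
Qed.

(** The parities of the exponents of the image determine the off-diagonal part. *)
Lemma veronese_lead_inj (m : 'X_{1..10}) (i : 'I_1) (m' : 'X_{1..10}) (i' : 'I_1) :
  irreducible veronese_rules m i -> irreducible veronese_rules m' i' ->
  img_lead (mu_of 3 veronese_lead) (nu_of 3 [:: [::]]) m i =
  img_lead (mu_of 3 veronese_lead) (nu_of 3 [:: [::]]) m' i' -> m = m' /\ i = i'.
Proof.
rewrite (ord1 i) (ord1 i') => nm nm' e; split=> //.
have E t : (t < 4)%N -> _ := fun ht => congr1 (fun f : 'X_{1..4} => f (inord t)) e.
move: (E 0%N isT) (E 1%N isT) (E 2%N isT) (E 3%N isT).
rewrite !img_leadE // /= !big_cons !big_nil /= ?(addn0, add0n, mul0n, mul1n).
move=> E0 E1 E2 E3; apply: mnm_inordP.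
have [v vO ev] : exists2 v, v \in off_diagonals & off_diagonal m = v.
  by exists (off_diagonal m) => //; exact: irreducible_off_diagonal.
have [v' vO' ev'] : exists2 v', v' \in off_diagonals & off_diagonal m' = v'.
  by exists (off_diagonal m') => //; exact: irreducible_off_diagonal.
clear nm nm' e E.
move: v' vO' ev' v vO ev.
do 8 (apply: in_cons_all; first (
  move=> [e1' e3' e4' e5' e6' e8'];
  do 8 (apply: in_cons_all; first (
    move=> [e1 e3 e4 e5 e6 e8] t ht;
    do 10 (case: t ht => [|t] ht; first by lia); by [])); by [])).
by [].
Qed.

(** * The annihilator of eps in coordinates *)

Section Annihilator.
Variable K : fieldType.
Hypothesis two_neq0 : 2%:R != 0 :> K.
Local Notation S := {mpoly K[10]}.
Local Notation X := (@gen K 9).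
Local Notation chartX := (chart (@gen K 5)).

Definition veronese_hom := subst_gen (veronese (@gen K 3)).

HB.instance Definition _ := GRing.RMorphism.copy veronese_hom (subst_gen (veronese (@gen K 3))).

(** The homomorphism f eps comes from a vector field. *)
Definition scales_jvec (f : S) : Prop := exists t : nat -> S,
  forall k, (k < 6)%N -> sqz_span X (dsqz X t k - f * jvec S k).

Lemma jvec_morph (R R' : comNzRingType) (h : {rmorphism R -> R'}) k :
  h (jvec R k) = jvec R' k.
Proof. by rewrite /jvec rmorph_nat. Qed.

(** A matrix f J of Pfaffian zero forces f = 0. *)
Lemma scales_jvec_veronese f : scales_jvec f -> veronese_hom f = 0.
Proof.
move=> [t ht]; pose u j := veronese_hom (t j).
have E k : (k < 6)%N -> dsqz (veronese (@gen K 3)) u k = veronese_hom f * jvec _ k.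
  move=> /ht/(sqz_span_subst (sqz_veronese (@gen K 3))) /eqP.
  rewrite rmorphB rmorphM /= jvec_morph subr_eq0 => /eqP <-.
  by rewrite [RHS]subst_gen_dsqz.
have := dsqz_veronese_pfaff (@gen K 3) u.
rewrite !E // /jvec /= !(mulr0, mul0r, mulr1, sub0r, addr0) => /eqP.
by rewrite oppr_eq0 mulf_eq0 orbb => /eqP.
Qed.

Lemma scales_jvec0 : scales_jvec 0.
Proof.
by exists (fun=> 0) => k hk; rewrite dsqz0 mul0r subrr; exact: sqz_span0.
Qed.

Lemma scales_jvecD f g : scales_jvec f -> scales_jvec g -> scales_jvec (f + g).
Proof.
move=> [t ht] [u hu]; exists (fun j => t j + u j) => k hk.
by rewrite dsqzD mulrDl opprD addrACA; apply: sqz_spanD; [exact: ht|exact: hu].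
Qed.

Lemma scales_jvecM c f : scales_jvec f -> scales_jvec (c * f).
Proof.
move=> [t ht]; exists (fun j => c * t j) => k hk.
by rewrite dsqzZ -mulrA -mulrBr; apply/sqz_spanM/ht.
Qed.

Lemma idx_lt a b : (idx a b < 10)%N.
Proof. by case: a b => [|[|[|[|[|a]]]]] [|[|[|[|[|b]]]]]. Qed.

Lemma symp_morph (R R' : comNzRingType) (h : {rmorphism R -> R'}) a b :
  h (symp R a b) = symp R' a b.
Proof. by rewrite /symp rmorphB !rmorph_nat. Qed.

Lemma chart_hom_minor p q r s : chart_hom (minor X p q r s) = minor chartX p q r s.
Proof. by rewrite /minor rmorphB !rmorphM /= !chart_hom_gen ?idx_lt. Qed.

Lemma chart_hom_minor_field p q r s j :
  chart_hom (minor_field X p q r s j) = minor_field chartX p q r s j.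
Proof.
rewrite /minor_field !(rmorph_nat, symp_morph, rmorphB, rmorphD, rmorphM) /=.
by rewrite !chart_hom_gen ?idx_lt // /symp.
Qed.

Lemma chart_kernelB (p q : S) : chart_hom p = chart_hom q -> sqz_span X (p - q).
Proof. by move=> e; apply: chart_kernel; rewrite rmorphB /= e subrr. Qed.

Lemma minor_field_span p q r s k : (p, q, r, s) \in minors -> (k < 6)%N ->
  sqz_span X (dsqz X (minor_field X p q r s) k - 4%:R * (minor X p q r s * jvec S k)).
Proof.
move=> hu hk; apply: chart_kernelB; rewrite !rmorphM rmorph_nat /= jvec_morph.
rewrite chart_hom_minor -(minor_field_chart (gen 5) hu hk) chart_hom_dsqz.
by apply: eq_quad => i j _ _; rewrite !chart_hom_minor_field.
Qed.

Lemma four_inv : (4%:R^-1)%:MP * 4%:R = 1 :> S.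
Proof.
rewrite -(rmorph_nat (@mpolyC 10 K)) -mpolyCM mulVf ?mpolyC1 //.
by rewrite -[4%N]/(2 * 2)%N natrM mulf_neq0.
Qed.

Lemma scales_jvec_minor p q r s : (p, q, r, s) \in minors -> scales_jvec (minor X p q r s).
Proof.
move=> hu; exists (fun j => (4%:R^-1)%:MP * minor_field X p q r s j) => k hk.
have := sqz_spanM (4%:R^-1)%:MP (minor_field_span hu hk).
by rewrite dsqzZ mulrBr [_ * (4%:R * _)]mulrA four_inv mul1r.
Qed.

Lemma veronese_leads (j : 'I_10) : leads (weights [::])
  (tnth [tuple veronese (@gen K 3) j | j < 10] j) (mu_of 3 veronese_lead j).
Proof.
rewrite tnth_mktuple /mu_of /veronese_lead (nth_map 0%N) ?size_iota // nth_iota // add0n.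
rewrite /veronese /gen -mpolyXD !mon_cons /mon big_nil addm0; exact: leadsX.
Qed.

(** The elements [f] with [scales_jvec f] form an ideal that contains the minors,
    and the minors rewrite every polynomial into normal monomials, which are
    independent on the cone. *)
Lemma veronese_scales_jvec p : veronese_hom p = 0 -> scales_jvec p.
Proof.
move=> p0; pose U (F : 'rV[S]_1) := scales_jvec (F 0 0).
have [| | | | |G UG nG] := @rules_normal_form K 9 0 veronese_wt [::] veronese_rules U
  _ _ _ _ _ (const_mx p).
- by rewrite /U mxE; exact: scales_jvec0.
- by move=> F G UF UG; rewrite /U mxE; exact: scales_jvecD.
- by move=> c F UF; rewrite /U mxE; exact: scales_jvecM.
- by [].
- move=> r /mapP[[[[a b] c] d] hu ->]; rewrite /U mxE [X in _ + X]mxE.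
  have := scales_jvec_minor hu; congr scales_jvec.
  rewrite term_entry tail_entry /= big_cons big_nil /= !mpolyXE.
  have e0 : (0 == inord 0 :> 'I_1) by rewrite -val_eqE /= inordK.
  by rewrite !e0 /minor /gen /=; ring.
suff G0 : G = 0 by have := UG; rewrite /U G0 subr0 mxE.
apply: (normal_inj (y := fun=> 1) veronese_leads _ veronese_lead_inj) => //.
  by move=> i; rewrite ord1 /nu_of /= /mon big_nil; exact: leads1.
rewrite big_ord1 mulr1; have := scales_jvec_veronese UG; rewrite !mxE rmorphB /= p0 sub0r => /eqP.
by rewrite oppr_eq0 => /eqP.
Qed.

(** The derivation of the polynomial ring with value [t j] on the variable [j]. *)
Definition vfield (t : nat -> S) (p : S) : S := \sum_(j < 10) t j * p^`M(j).

Lemma vfield_is_linear t : linear (vfield t).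
Proof.
move=> a p q; rewrite /vfield scaler_sumr -big_split; apply: eq_bigr => j _ /=.
by rewrite linearP mulrDr scalerAr.
Qed.

HB.instance Definition _ t := GRing.isLinear.Build K S S _ (vfield t) (vfield_is_linear t).

Lemma vfieldM t p q : vfield t (p * q) = p * vfield t q + q * vfield t p.
Proof.
rewrite /vfield !mulr_sumr -big_split; apply: eq_bigr => j _ /=.
by rewrite mderivM; ring.
Qed.

Lemma vfield_gen t j : (j < 10)%N -> vfield t (X j) = t j.
Proof.
move=> hj; rewrite /vfield (bigD1 (inord j)) //= big1 ?addr0.
  rewrite /gen mderivX mnm1E eqxx scale1r inordK //.
  by rewrite -[X in 'X_[X - _]]addm0 addmC addmK mpolyX0 mulr1.
by move=> i /negbTE hi; rewrite /gen mderivX mnm1E eq_sym hi scale0r mulr0.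
Qed.

Lemma vfield_sqz t k : vfield t (sqz X k) = dsqz X t k.
Proof.
have E i j : (i < 10)%N -> (j < 10)%N -> vfield t (X i * X j) = X i * t j + t i * X j.
  by move=> hi hj; rewrite vfieldM !vfield_gen // [X j * _]mulrC.
by rewrite quad_morph; apply: eq_quad => i j hi hj; rewrite /= E.
Qed.

(** J respects all syzygies of the quadrics.  For the minor f = a12^2 - a11 a22 and
    its field t, the relation f J = dsqz t holds modulo the quadrics, and a syzygy
    differentiated along t is a syzygy of dsqz t modulo the quadrics.  So f times
    the value on J vanishes in A, where f is not a zero divisor. *)
Lemma syzygy_jvec (c : nat -> S) : \sum_(k < 6) c k * sqz X k = 0 ->
  sqz_span X (\sum_(k < 6) c k * jvec S k).
Proof.
move=> c0; have hu : (0, 1, 1, 0)%N \in minors by [].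
have [t ht] := scales_jvec_minor hu; set f := minor _ _ _ _ _ in ht.
have : sqz_span X (f * \sum_(k < 6) c k * jvec S k).
  rewrite (_ : f * _ = \sum_(k < 6) c k * (f * jvec S k - dsqz X t k)
                     - \sum_(k < 6) vfield t (c k) * sqz X k).
    apply: sqz_spanB; last by exists (fun k => vfield t (c k)).
    elim/big_ind: _ => [|p q|k _]; [exact: sqz_span0|exact: sqz_spanD|].
    by apply: sqz_spanM; rewrite -opprB; apply/sqz_spanN/ht.
  have /(congr1 (vfield t)) := c0; rewrite linear_sum linear0 /=.
  under eq_bigr do rewrite vfieldM vfield_sqz.
  rewrite big_split /= => /eqP; rewrite addr_eq0 => /eqP E.
  under [X in X - _]eq_bigr do rewrite mulrBr.
  rewrite sumrB E; under [X in _ - _ - X]eq_bigr do rewrite mulrC.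
  rewrite opprK addrK mulr_sumr; apply: eq_bigr => k _; exact: mulrCA.
move/chart_sqz_span/eqP; rewrite rmorphM mulf_eq0 => /orP[|/eqP/chart_kernel//].
rewrite /= chart_hom_minor /minor /chart /= subr_eq0 /gen -!mpolyXD.
move=> /eqP/(congr1 (mcoeff (U_(inord 1) + U_(inord 1))%MM)).
rewrite !mcoeffX eqxx; case: eqP => [/(congr1 (fun m : 'X_{1..6} => m (inord 0)))|_ /eqP].
  by rewrite !mnmDE !mnm1E !inord_eq.
by rewrite oner_eq0.
Qed.

End Annihilator.

(** * Algebraic dependence and chains of primes *)

Section AlgebraicDependence.
Variable K : fieldType.

(** A matrix with more rows than columns has a nonzero row in its left kernel. *)
Lemma linear_dependence (I J : finType) (F : I -> J -> K) : (#|J| < #|I|)%N ->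
  exists v : I -> K, (exists i, v i != 0) /\ forall j, \sum_i v i * F i j = 0.
Proof.
move=> lt; pose A := \matrix_(i < #|I|, j < #|J|) F (enum_val i) (enum_val j).
have /rowV0Pn[w wk w0] : kermx A != 0.
  rewrite -mxrank_eq0 mxrank_ker -lt0n subn_gt0.
  exact: leq_ltn_trans (rank_leq_col A) lt.
exists (fun i => w 0 (enum_rank i)); split.
  have /rV0Pn[i wi] := w0; exists (enum_val i); by rewrite enum_valK.
move=> j; have /(congr1 (fun B : 'rV_ _ => B 0 (enum_rank j))) := sub_kermxP wk.
rewrite !mxE => E; rewrite -[RHS]E (reindex (@enum_val I predT)) /=; last first.
  by apply: onW_bij; exact: enum_val_bij.
by apply: eq_bigr => i _; rewrite !mxE enum_valK enum_rankK.
Qed.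

(** The monomials in g with exponents below M number M^n, while their degrees
    grow linearly in M, so for M large they outnumber the monomials in r < n
    variables available to them. *)
Lemma algebraic_dependence n r (g : n.-tuple {mpoly K[r]}) : (r < n)%N ->
  exists2 P : {mpoly K[n]}, P != 0 & P \mPo g = 0.
Proof.
move=> ltrn; pose d := \max_(i < n) msize (tnth g i).
(* [B] bounds the degrees, hence the exponents, of the monomials in g *)
pose q := (n * d.+3).+1; pose M := (q ^ r).+1; pose B := (M * q)%N.
pose mnm (e : {ffun 'I_n -> 'I_M}) : 'X_{1..n} := [multinom (e i : nat) | i < n].
pose mnm' (e : {ffun 'I_r -> 'I_B}) : 'X_{1..r} := [multinom (e i : nat) | i < r].
have [|v [[e0 ve0] hv]] := @linear_dependence {ffun 'I_n -> 'I_M} {ffun 'I_r -> 'I_B}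
    (fun e c => ('X_[mnm e] \mPo g)@_(mnm' c)).
  rewrite !card_ffun !card_ord /B expnMn.
  apply: (@leq_trans (M ^ r.+1)); last by rewrite leq_exp2l // ltnS expn_gt0.
  by rewrite expnSr ltn_pmul2l ?expn_gt0 // ltnS.
exists (\sum_e v e *: 'X_[mnm e]).
  apply: contraNneq ve0 => /(congr1 (mcoeff (mnm e0))).
  rewrite mcoeff0 raddf_sum (bigD1 e0) //= mcoeffZ mcoeffX eqxx mulr1 big1 ?addr0.
    by move=> ->.
  move=> e /negP ne; rewrite mcoeffZ mcoeffX; case: eqP => [h|]; last by rewrite mulr0.
  case: ne; apply/eqP/ffunP => i; apply/val_inj.
  by move/mnmP/(_ i): h; rewrite !mnmE.
apply/mpolyP => m; rewrite mcoeff0 (raddf_sum (comp_mpoly g)) raddf_sum /=.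
have [/existsP[i hi]|/existsPn hm] := boolP [exists i, (B <= m i)%N].
  apply: big1 => e _; rewrite comp_mpolyZ mcoeffZ memN_msupp_eq0 ?mulr0 //.
  apply/negP => /msize_mdeg_lt; apply/negP; rewrite -leqNgt.
  have : (msize ('X_[mnm e] \mPo g) <= B)%N.
    rewrite comp_mpolyX.
    have le1 (f : {mpoly K[r]}) k : (msize f <= d)%N -> (msize (f ^+ k) <= (k * d.+1).+1)%N.
      move=> hf; elim: k => [|k IH]; first by rewrite expr0 msize1.
      rewrite exprS mulSn; apply: leq_trans (msizeM_le _ _) _; lia.
    apply: (@leq_trans (\sum_(i < n) (M.-1 * d.+1).+2).+1).
      elim/big_rec2: _ => [|j x y _ IH]; first by rewrite msize1.
      apply: leq_trans (msizeM_le _ _) _.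
      have h1 : (msize (tnth g j ^+ mnm e j) <= (mnm e j * d.+1).+1)%N.
        by apply: le1; exact: (leq_bigmax (F := fun i => msize (tnth g i))).
      have h2 : (mnm e j * d.+1 <= M.-1 * d.+1)%N.
        by rewrite leq_mul2r mnmE -ltnS prednK // ltn_ord orbT.
      lia.
    rewrite sum_nat_const card_ord /B /q /M /=; nia.
  move=> h; apply: leq_trans h _; apply: leq_trans hi _.
  by rewrite mdegE (bigD1 i) //= leq_addr.
have hlt i : (m i < B)%N by rewrite ltnNge hm.
pose c : {ffun 'I_r -> 'I_B} := [ffun i => Ordinal (hlt i)].
rewrite -[RHS](hv c); apply: eq_bigr => e _; rewrite comp_mpolyZ mcoeffZ.
by congr (_ * _@_ _); apply/mnmP => i; rewrite mnmE ffunE.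
Qed.

End AlgebraicDependence.

Section Chain.
Variables (K : fieldType) (A : comNzRingType) (iota : {rmorphism K -> A}).
Variables (n : nat) (p : nat -> prime_idealr A) (a : 'I_n -> A).
Hypotheses (pS : forall i, (i < n)%N -> {subset p i <= p i.+1}).
Hypotheses (ap : forall i : 'I_n, a i \notin p i) (ap' : forall i : 'I_n, a i \in p i.+1).

Lemma prime_exp (P : prime_idealr A) x k : x \notin P -> x ^+ k \notin P.
Proof.
move=> h; elim: k => [|k IH]; first by rewrite expr0 idealr1.
by rewrite exprS prime_idealrM negb_or h.
Qed.

(** Keep the monomials of [P] with the least exponent of a_0, divide by this power
    of a_0, which is not in p_0, and pass to p_1, which contains a_0: this gives a
    relation in a_1, a_2, ... modulo p_1.  At the end of the chain a nonzero
    constant is left. *)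
Lemma chain_independent (P : {mpoly K[n]}) : mmap iota a P \in p 0%N -> P = 0.
Proof.
move=> hP; apply/eqP; apply: contraT => P0.
suff h k : (k <= n)%N -> exists E : seq 'X_{1..n},
    [/\ E != [::], uniq E, {subset E <= msupp P},
        forall m m' (j : 'I_n), m \in E -> m' \in E -> (j < k)%N -> m j = m' j &
        \sum_(m <- E) iota P@_m * \prod_(j < n | (k <= j)%N) a j ^+ m j \in p k].
  have [[|m [|m' E]] [// _ Eu Es Ee]] := h n (leqnn n); last first.
    suff e : m = m' by move: Eu; rewrite /= e in_cons eqxx.
    by apply/mnmP => j; apply: Ee; rewrite ?in_cons ?eqxx ?orbT.
  rewrite big_seq1 big1 ?mulr1; last by move=> j; rewrite leqNgt ltn_ord.
  have : P@_m != 0 by rewrite -mcoeff_msupp Es ?mem_head.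
  move=> c0 /(idealMr (iota (P@_m)^-1)); rewrite -rmorphM mulVf // rmorph1.
  by rewrite idealr1.
elim: k => [_|k IH kn].
  exists (msupp P); rewrite msupp_eq0 P0 msupp_uniq; split=> //.
have [E [E0 Eu Es Ee hE]] := IH (ltnW kn).
pose k' := Ordinal kn.
have [m0 m0E m0min] : exists2 m0, m0 \in E & forall m, m \in E -> (m0 k' <= m k')%N.
  move: E0; elim: (E) => // m [|m' l] IHl _.
    by exists m; [exact: mem_head|move=> x; rewrite inE => /eqP->].
  have [//|m1 m1l m1min] := IHl.
  have [le|lt] := leqP (m k') (m1 k').
    exists m; first exact: mem_head.
    by move=> x; rewrite in_cons => /orP[/eqP->//|/m1min]; exact: leq_trans.
  exists m1; first by rewrite in_cons m1l orbT.
  by move=> x; rewrite in_cons => /orP[/eqP->|/m1min//]; exact: ltnW.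
pose Q (m : 'X_{1..n}) := m k' == m0 k'.
exists [seq m <- E | Q m]; split.
- by rewrite -has_filter; apply/hasP; exists m0 => //; exact: eqxx.
- exact: filter_uniq.
- by move=> m; rewrite mem_filter => /andP[_ /Es].
- move=> m m' j; rewrite !mem_filter => /andP[/eqP q hm] /andP[/eqP q' hm'].
  rewrite ltnS leq_eqVlt => /orP[/eqP ej|]; last exact: Ee.
  by rewrite (_ : j = k') ?q ?q' //; apply: val_inj.
rewrite big_filter.
pose T m := iota P@_m * \prod_(j < n | (k.+1 <= j)%N) a j ^+ m j.
have hE' : a k' ^+ m0 k' * (\sum_(m <- E) a k' ^+ (m k' - m0 k') * T m) \in p k.
  rewrite -[X in X \in _](_ : \sum_(m <- E) iota P@_m *
    \prod_(j < n | (k <= j)%N) a j ^+ m j = _) //.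
  rewrite mulr_sumr big_seq [RHS]big_seq.
  apply: eq_bigr => m hm; rewrite mulrA -exprD subnKC ?m0min // (bigD1 k') //=.
  rewrite mulrCA; congr (_ * (_ * _)); apply: eq_bigl => j.
  by rewrite -val_eqE /= ltn_neqAle eq_sym andbC.
have : \sum_(m <- E) a k' ^+ (m k' - m0 k') * T m \in p k.+1.
  apply: (pS kn); move: hE'; rewrite prime_idealrM => /orP[|//].
  by rewrite (negbTE (prime_exp _ (ap k'))).
rewrite (bigID Q) /= => h.
have h2 : \sum_(m <- E | ~~ Q m) a k' ^+ (m k' - m0 k') * T m \in p k.+1.
  rewrite big_seq_cond; apply: rpred_sum => m /andP[hm Qm].
  have : (0 < m k' - m0 k')%N.
    by rewrite subn_gt0 ltn_neqAle eq_sym Qm m0min.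
  case: (m k' - m0 k')%N => // l _.
  by rewrite exprS -mulrA mulrC; apply: idealMr; exact: (ap' k').
have := rpredB h h2; rewrite addrK; apply: etrans; congr (_ \in p k.+1).
by apply: eq_bigr => m /eqP ->; rewrite subnn mul1r.
Qed.

End Chain.

(** * The module T^1 *)

Section Hom.
Variables (A : comNzRingType) (M N : lmodType A).
Implicit Types f g : @Defs.hom A M N.

Lemma hom_addE f g x : val (f + g) x = val f x + val g x.
Proof. by []. Qed.

Lemma hom_scaleE (a : A) f x : val (a *: f) x = a *: val f x.
Proof. by []. Qed.

End Hom.

Section Module.
Local Open Scope quotient_scope.
Variables (K : fieldType) (S : comAlgType K) (I : idealr S).
Hypothesis two_neq0 : 2%:R != 0 :> K.
Local Notation S0 := {mpoly K[10]}.
Local Notation X := (@gen K 9).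
Variables (param : {lrmorphism S0 -> S}) (unparam : {lrmorphism S -> S0}).
Hypotheses (paramK : cancel param unparam) (unparamK : cancel unparam param).
Hypothesis memI : forall s, s \in I <-> sqz_span X (unparam s).
Local Notation A := {ideal_quot I}.

(** The ring A as a quotient of the polynomial ring in the entries of S. *)
Definition cls (p : S0) : A := \pi_A (param p).

HB.instance Definition _ := GRing.RMorphism.copy cls (\pi_A \o param).

Lemma cls_eq0 p : cls p = 0 <-> sqz_span X p.
Proof.
rewrite -[p in sqz_span X p]paramK -memI -(rmorph0 (\pi_A)) /cls.
have -> : (param p \in I) = (param p - 0 \in I) by rewrite subr0.
by rewrite Quotient.idealrBE; split=> /eqP.
Qed.

Lemma cls_eq p q : cls p = cls q <-> sqz_span X (p - q).
Proof.
rewrite -cls_eq0 rmorphB /=; split=> [->|/eqP]; first by rewrite subrr.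
by rewrite subr_eq0 => /eqP.
Qed.

Definition lift (a : A) : S0 := unparam (repr a).

Lemma liftK a : cls (lift a) = a.
Proof. by rewrite /cls /lift unparamK reprK. Qed.

Lemma sqz_in_I k : param (sqz X k) \in I.
Proof. by apply/memI; rewrite paramK; exact: sqz_span_gen. Qed.

Definition quadric k : ideal_elt I := exist _ (param (sqz X k)) (sqz_in_I k).

Lemma conormal_scaleE p (y : ideal_elt I) :
  cls p *: conormal_pi y = conormal_pi (ideal_mul (param p) y).
Proof. exact: conormal_piZ. Qed.

Lemma conormal_pi0 : conormal_pi 0 = 0 :> conormal I.
Proof. by rewrite /conormal_pi raddf0. Qed.

Lemma coords_span (y : ideal_elt I) (c : nat -> S0) :
  unparam (val y) = \sum_(k < 6) c k * sqz X k ->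
  conormal_pi y = \sum_(k < 6) cls (c k) *: conormal_pi (quadric k).
Proof.
move=> e; have -> : y = \sum_(k < 6) ideal_mul (param (c k)) (quadric k).
  apply: val_inj; rewrite raddf_sum /= -[LHS]unparamK e rmorph_sum.
  by apply: eq_bigr => k _; rewrite rmorphM.
rewrite (big_morph _ (@conormal_piD S I) conormal_pi0).
by apply: eq_bigr => k _; rewrite conormal_scaleE.
Qed.

Lemma coords_exist (y : ideal_elt I) :
  exists c : nat -> S0, unparam (val y) = \sum_(k < 6) c k * sqz X k.
Proof. by have /memI := valP y. Qed.

Lemma nm_addE (phi psi : normal_module I) x :
  val (phi + psi) x = val phi x + val psi x.
Proof. exact: (@hom_addE _ (conormal I) _ phi psi x). Qed.

Lemma nm_scaleE (a : A) (phi : normal_module I) x :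
  val (a *: phi) x = a * val phi x.
Proof. exact: (@hom_scaleE _ (conormal I) _ a phi x). Qed.

Section Eval.
Variable phi : normal_module I.

Lemma nm_linear : linear (val phi : conormal I -> A^o).
Proof. exact/asboolP/(valP phi). Qed.

Lemma nmD u v : val phi (u + v) = val phi u + val phi v.
Proof. by have := nm_linear 1 u v; rewrite !scale1r. Qed.

Lemma nm0 : val phi 0 = 0.
Proof. by apply: (addrI (val phi 0)); rewrite -nmD !addr0. Qed.

Lemma nmZ a u : val phi (a *: u) = a * val phi u.
Proof. by have := nm_linear a u 0; rewrite nm0 !addr0. Qed.

Lemma nm_eval (y : ideal_elt I) (c : nat -> S0) :
  unparam (val y) = \sum_(k < 6) c k * sqz X k ->
  val phi (conormal_pi y) =
  \sum_(k < 6) cls (c k) * val phi (conormal_pi (quadric k)).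
Proof.
move=> /coords_span ->; rewrite (big_morph _ nmD nm0).
by apply: eq_bigr => k _; rewrite nmZ.
Qed.

Definition nm_lift (k : nat) : S0 := lift (val phi (conormal_pi (quadric k))).

(** A homomorphism from the conormal module respects the syzygies of the quadrics. *)
Lemma nm_syzygy (c : nat -> S0) : \sum_(k < 6) c k * sqz X k = 0 ->
  sqz_span X (\sum_(k < 6) c k * nm_lift k).
Proof.
move=> e; apply/cls_eq0; rewrite rmorph_sum.
under eq_bigr do rewrite rmorphM /= liftK.
rewrite -(@nm_eval 0 c); last by rewrite e raddf0.
by rewrite conormal_pi0; exact: nm0.
Qed.

End Eval.

Lemma nm_ext (phi psi : normal_module I) :
  (forall k, (k < 6)%N ->
     val phi (conormal_pi (quadric k)) = val psi (conormal_pi (quadric k))) ->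
  phi = psi.
Proof.
move=> h; apply/val_inj/funext; elim/conormalW => y.
have [c hc] := coords_exist y; rewrite !(nm_eval _ hc).
by apply: eq_bigr => k _; rewrite h.
Qed.

(** The value of J on a choice of coefficients with respect to the quadrics. *)
Definition eps_elt (y : ideal_elt I) : A :=
  cls (\sum_(k < 6) projT1 (cid (coords_exist y)) k * jvec S0 k).

(** The choice of the coefficients is irrelevant because J respects syzygies. *)
Lemma eps_eltE (y : ideal_elt I) (c : nat -> S0) : unparam (val y) = \sum_(k < 6) c k * sqz X k ->
  eps_elt y = cls (\sum_(k < 6) c k * jvec S0 k).
Proof.
move=> e; rewrite /eps_elt; case: cid => d /= hd; apply/cls_eq.
rewrite -sumrB; under eq_bigr do rewrite -mulrBl.
apply: (syzygy_jvec two_neq0 (c := fun k => d k - c k)).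
under eq_bigr do rewrite mulrBl.
by rewrite sumrB -hd -e subrr.
Qed.

Lemma eps_eltD y z : eps_elt (y + z) = eps_elt y + eps_elt z.
Proof.
have [c hc] := coords_exist y; have [d hd] := coords_exist z.
rewrite (eps_eltE hc) (eps_eltE hd) -rmorphD -big_split /=.
under eq_bigr do rewrite -mulrDl.
apply: (eps_eltE (c := fun k => c k + d k)).
under eq_bigr do rewrite mulrDl.
by rewrite (_ : val (y + z) = val y + val z) // rmorphD /= hc hd -big_split.
Qed.

Lemma eps_eltM p y : eps_elt (ideal_mul (param p) y) = cls p * eps_elt y.
Proof.
have [c hc] := coords_exist y; rewrite (eps_eltE hc) -rmorphM mulr_sumr.
under eq_bigr do rewrite mulrA.
apply: (eps_eltE (c := fun k => p * c k)).
under eq_bigr do rewrite -mulrA.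
by rewrite -mulr_sumr -hc /= rmorphM /= paramK.
Qed.

Lemma eps_elt0 : eps_elt 0 = 0.
Proof. by apply: (addrI (eps_elt 0)); rewrite -eps_eltD !addr0. Qed.

Lemma eps_elt_sq z : z \in @ideal_sq S I -> eps_elt z = 0.
Proof.
move=> /asboolP[s hs].
have -> : z = \sum_(p <- s) ideal_mul (param (unparam (val p.1))) p.2.
  apply: val_inj; rewrite raddf_sum /= hs.
  by apply: eq_bigr => p _; rewrite unparamK.
rewrite (big_morph _ eps_eltD eps_elt0) big1 // => p _.
rewrite eps_eltM (_ : cls _ = 0) ?mul0r //.
by apply/cls_eq0/memI; exact: valP p.1.
Qed.

Definition eps_fun (x : conormal I) : A := eps_elt (repr x).

Lemma eps_fun_cls y : eps_fun (conormal_pi y) = eps_elt y.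
Proof.
have /eps_elt_sq : repr (conormal_pi y) - y \in @ideal_sq S I.
  by apply/conormal_piP/conormal_reprK.
move=> e; rewrite /eps_fun -[repr _](subrK y) eps_eltD e add0r //.
Qed.

Lemma eps_linear : eps_fun \in @is_linear A (conormal I) A^o.
Proof.
apply/asboolP => a u v; rewrite -[a]liftK.
elim/conormalW: u => y; elim/conormalW: v => z.
by rewrite conormal_scaleE -conormal_piD !eps_fun_cls eps_eltD eps_eltM.
Qed.

Definition eps : normal_module I :=
  exist (fun f => f \in @is_linear A (conormal I) A^o) _ eps_linear.

Lemma eps_quadric k : (k < 6)%N -> val eps (conormal_pi (quadric k)) = cls (jvec S0 k).
Proof.
move=> hk; rewrite [LHS]eps_fun_cls (@eps_eltE _ (fun j => (j == k)%:R)) /=.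
  congr cls; rewrite (bigD1 (Ordinal hk)) //= eqxx mul1r big1 ?addr0 // => j.
  by rewrite -val_eqE /= => /negbTE ->; rewrite mul0r.
rewrite paramK (bigD1 (Ordinal hk)) //= eqxx mul1r big1 ?addr0 // => j.
by rewrite -val_eqE /= => /negbTE ->; rewrite mul0r.
Qed.

Section Field.
Variable t : nat -> S0.

Definition field_fun : {linear S -> S} := param \o vfield t \o unparam.

Lemma field_leibniz f g : field_fun (f * g) = f * field_fun g + g * field_fun f.
Proof. by rewrite /= rmorphM vfieldM rmorphD !rmorphM /= !unparamK. Qed.

(** A vector field in the entries of S, transported to the given ring. *)
Definition field_der : derivation S := Derivation field_leibniz.

Lemma theta_field k :
  val (theta I field_der) (conormal_pi (quadric k)) = cls (dsqz X t k).
Proof. by rewrite /= theta_fun_pi /= paramK vfield_sqz. Qed.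

End Field.

Lemma theta_quadric (d : derivation S) k :
  val (theta I d) (conormal_pi (quadric k)) =
  cls (dsqz X (fun j => unparam (d (param (X j)))) k).
Proof.
rewrite /= theta_fun_pi /=; pose h : {linear S0 -> S0} := unparam \o d \o param.
rewrite /cls -[d _]unparamK; congr (\pi_A (param _)).
rewrite -[LHS]/(h (sqz X k)) quad_morph; apply: eq_quad => i j _ _.
by rewrite /= rmorphM der_leibniz rmorphD !rmorphM /= !paramK [X j * _]mulrC.
Qed.

(** The two linear syzygies are instances of [nm_syzygy]. *)
Lemma nm_structure (phi : normal_module I) : exists f t,
  phi = cls f *: eps + theta I (field_der t).
Proof.
have [||f [t h]] := @linear_syzygies_split K two_neq0 (nm_lift phi).
- pose c k := nth 0 [:: X 3 + X 6; - X 1; - X 2; X 0; X 1; 0] k.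
  have E (u : nat -> S0) : \sum_(k < 6) c k * u k = lsyz1 X u.
    by rewrite !big_ord_recl big_ord0 /c /lsyz1 /=; ring.
  by rewrite -E; apply: nm_syzygy; rewrite (E (sqz X)) lsyz1_sqz.
- pose c k := nth 0 [:: - X 9; X 4; X 6 - X 3; 0; - X 4; X 0] k.
  have E (u : nat -> S0) : \sum_(k < 6) c k * u k = lsyz2 X u.
    by rewrite !big_ord_recl big_ord0 /c /lsyz2 /=; ring.
  by rewrite -E; apply: nm_syzygy; rewrite (E (sqz X)) lsyz2_sqz.
exists f, t; apply: nm_ext => k hk.
rewrite nm_addE nm_scaleE eps_quadric // theta_field -rmorphM -rmorphD /= -[LHS]liftK.
apply/cls_eq; have := h k hk; rewrite /nm_lift.
by rewrite opprD addrA.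
Qed.

Definition eps_class : T1 I := quotmod_pi (@theta_image K S I) eps.

Lemma T1_cyclic (m : T1 I) : exists f, m = cls f *: eps_class.
Proof.
elim/quotmodW: m => phi; have [f [t ->]] := nm_structure phi; exists f.
rewrite -[RHS]/(quotmod_scale _ _) quotmod_piZ; apply/quotmod_piP.
by rewrite addrAC subrr add0r; apply/asboolP; exists (field_der t).
Qed.

(** On the quadrics a derivation depends only on its values on the entries of S,
    so the vector fields [field_der] account for all of them. *)
Lemma eps_class_ann f : cls f *: eps_class = 0 <-> veronese_hom f = 0.
Proof.
rewrite -[_ *: _]/(quotmod_scale _ _) quotmod_piZ.
rewrite (_ : 0 = quotmod_pi (@theta_image K S I) 0); last first.
  by rewrite /quotmod_pi raddf0.
rewrite quotmod_piP subr0.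
have E k : (k < 6)%N -> val (cls f *: eps) (conormal_pi (quadric k)) = cls (f * jvec S0 k).
  by move=> hk; rewrite nm_scaleE eps_quadric // rmorphM.
split=> [/asboolP[d hd]|/(veronese_scales_jvec two_neq0)[t ht]].
  apply: scales_jvec_veronese; exists (fun j => unparam (d (param (X j)))) => k hk.
  by apply/cls_eq; rewrite -theta_quadric -hd E.
apply/asboolP; exists (field_der t); apply: nm_ext => k hk.
by rewrite E // theta_field; apply/esym/cls_eq/ht.
Qed.

End Module.

(** * Purity *)

Lemma mmap_morph (K : fieldType) (n : nat) (A B : comNzRingType)
  (iota : {rmorphism K -> A}) (h : {rmorphism A -> B}) (a : 'I_n -> A) (P : {mpoly K[n]}) :
  h (mmap iota a P) = mmap (h \o iota) (h \o a) P.
Proof.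
rewrite /mmap rmorph_sum; apply: eq_bigr => m _; rewrite rmorphM; congr (_ * _).
by rewrite /mmap1 rmorph_prod; apply: eq_bigr => i _; rewrite rmorphXn.
Qed.

Section Truncation.
Variable K : fieldType.
Local Notation D := {mpoly K[4]}.

Definition zeros (j : nat) : 4.-tuple D := [tuple if (i < j)%N then 0 else 'X_i | i < 4].

Definition truncate (j : nat) (p : D) : D := p \mPo zeros j.

HB.instance Definition _ j := GRing.RMorphism.copy (truncate j) (comp_mpoly (zeros j)).

Lemma truncateX j i : truncate j 'X_i = if (i < j)%N then 0 else 'X_i.
Proof. by rewrite /truncate comp_mpolyXU -tnth_nth tnth_mktuple. Qed.

Lemma truncate0 p : truncate 0 p = p.
Proof. exact: comp_mpoly_id. Qed.

Lemma truncateS j p : truncate j.+1 p = truncate j.+1 (truncate j p).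
Proof.
rewrite {2}/truncate /comp_mpoly mmap_morph /truncate /comp_mpoly /mmap.
apply: eq_bigr => m _; congr (_ * _); first by rewrite /= mmapC.
apply: eq_bigr => i _; congr (_ ^+ _); rewrite /= -/(truncate j.+1 _) !tnth_mktuple.
rewrite -[RHS]/(truncate j.+1 _); case: (ltnP i j) => h; last by rewrite truncateX.
by rewrite rmorph0 ltnS ltnW.
Qed.

End Truncation.

Section Pure.
Local Open Scope quotient_scope.
Variables (K : fieldType) (S : comAlgType K) (I : idealr S).
Hypothesis two_neq0 : 2%:R != 0 :> K.
Local Notation S0 := {mpoly K[10]}.
Local Notation X := (@gen K 9).
Variables (param : {lrmorphism S0 -> S}) (unparam : {lrmorphism S -> S0}).
Hypotheses (paramK : cancel param unparam) (unparamK : cancel unparam param).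
Hypothesis memI : forall s, s \in I <-> sqz_span X (unparam s).
Local Notation A := {ideal_quot I}.
Local Notation cls := (@cls K S I param).
Local Notation lift := (@lift K S I unparam).

(** Restriction to the matrices x x^T for which the first [j] coordinates of x
    vanish. *)
Definition restriction (j : nat) (a : A) : {mpoly K[4]} := truncate j (veronese_hom (lift a)).

Lemma restriction_cls j p : restriction j (cls p) = truncate j (veronese_hom p).
Proof.
rewrite /restriction; congr truncate; apply/eqP; rewrite -subr_eq0 -rmorphB.
apply/eqP; apply: (sqz_span_subst (sqz_veronese (gen 3))).
by apply/(cls_eq paramK memI); rewrite (liftK unparamK).
Qed.

Definition cone_ideal (j : nat) : {pred A} := fun a => restriction j a == 0.

Lemma cone_idealE j p : (cls p \in cone_ideal j) = (truncate j (veronese_hom p) == 0).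
Proof. by rewrite -restriction_cls. Qed.

Lemma cone_ideal_closed j : idealr_closed (cone_ideal j).
Proof.
split.
- by rewrite -(rmorph0 cls) cone_idealE !rmorph0.
- by rewrite -(rmorph1 cls) cone_idealE !rmorph1 oner_eq0.
- move=> a u v; rewrite -[a](liftK unparamK) -[u](liftK unparamK) -[v](liftK unparamK).
  rewrite -rmorphM -rmorphD !cone_idealE !rmorphD !rmorphM /= => /eqP-> /eqP->.
  by rewrite mulr0 addr0.
Qed.

Lemma cone_ideal_prime j : prime_idealr_closed (cone_ideal j).
Proof.
move=> u v; rewrite -[u](liftK unparamK) -[v](liftK unparamK).
by rewrite -rmorphM !cone_idealE !rmorphM mulf_eq0.
Qed.

HB.instance Definition _ j := isIdealr.Build A (cone_ideal j) (cone_ideal_closed j).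
HB.instance Definition _ j :=
  isPrimeIdealrClosed.Build A (cone_ideal j) (@cone_ideal_prime j).

Definition cone_prime j : prime_idealr A := cone_ideal j.

Lemma cone_primeE j p : (cls p \in cone_prime j) = (truncate j (veronese_hom p) == 0).
Proof. exact: cone_idealE. Qed.

Lemma cone_prime_sub j : {subset cone_prime j <= cone_prime j.+1}.
Proof.
move=> a; rewrite -[a](liftK unparamK) !cone_primeE truncateS => /eqP->.
by rewrite rmorph0.
Qed.

Lemma cone_prime0_sub j : {subset cone_prime 0 <= cone_prime j}.
Proof. by elim: j => // j IH a /IH; exact: cone_prime_sub. Qed.

Lemma cone_prime_proper j : (j < 4)%N -> ~ {subset cone_prime j.+1 <= cone_prime j}.
Proof.
move=> hj /(_ (cls (X (idx j j)))); rewrite !cone_primeE /veronese_hom subst_genE ?idx_lt //.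
have -> : veronese (gen 3) (idx j j) = gen 3 j * gen 3 j :> {mpoly K[4]}.
  by do 4 (case: j hj => [|j] hj //).
rewrite !rmorphM /= !truncateX inordK // ltnSn ltnn mul0r eqxx => /(_ isT).
by rewrite mulf_eq0 orbb -msupp_eq0 msuppX.
Qed.

Lemma eps_ann_cone b f : veronese_hom f != 0 ->
  b *: (cls f *: eps_class two_neq0 paramK unparamK memI) = 0 -> b \in cone_prime 0.
Proof.
move=> f0; rewrite -[b](liftK unparamK) scalerA -rmorphM eps_class_ann => /eqP.
by rewrite rmorphM mulf_eq0 (negbTE f0) orbF cone_primeE truncate0.
Qed.

(** Every nonzero element is a multiple f eps with f outside the prime ideal of
    the cone, so its annihilator is this ideal. *)
Lemma cone_chain (N : {pred T1 I}) m : m \in N -> m != 0 -> dim_ge (Defs.support N) 4.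
Proof.
move=> mN m0; have [f e] := T1_cyclic two_neq0 paramK unparamK memI m.
have f0 : veronese_hom f != 0.
  apply: contraNneq m0 => h; rewrite e; apply/eqP.
  by apply/(eps_class_ann two_neq0 paramK unparamK memI).
exists cone_prime; split=> [i _|i hi]; last first.
  by split; [exact: cone_prime_sub|exact: cone_prime_proper].
exists m => // b; rewrite e => /(eps_ann_cone f0); exact: cone_prime0_sub.
Qed.

Lemma eps_class_neq0 : eps_class two_neq0 paramK unparamK memI != 0.
Proof.
apply/eqP => e; have : cls 1 *: eps_class two_neq0 paramK unparamK memI = 0.
  by rewrite e scaler0.
by rewrite eps_class_ann rmorph1 => /eqP; rewrite oner_eq0.
Qed.

(** Five elements separating the primes of a longer chain restrict to
    algebraically dependent functions on the cone.  The relation then kills eps,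
    hence T^1, hence lies in the smallest prime. *)
Lemma T1_dim_le : ~ dim_ge (Defs.support (predT : {pred T1 I})) 5.
Proof.
move=> [p [psup pS]].
have ex (i : 'I_5) : exists a : A, a \in p i.+1 /\ a \notin p i.
  apply/not_existsP => h; case: (pS i (ltn_ord i)) => _; apply=> a ha.
  by apply: contrapT => /negP na; apply: (h a).
pose a i := projT1 (cid (ex i)).
have aP i : a i \in p i.+1 /\ a i \notin p i by exact: projT2 (cid (ex i)).
have [P P0 hP] := @algebraic_dependence K 5 4
  [tuple veronese_hom (lift (a i)) | i < 5] isT.
pose iota : {rmorphism K -> A} := cls \o @mpolyC 10 K.
move/eqP: P0; apply.
apply: (@chain_independent K A iota 5 p a) => [i /pS[]//|i|i|].
- by have [] := aP i.
- by have [] := aP i.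
have [m _ hm] := psup 0%N isT; apply: hm.
pose F := mmap (@mpolyC 10 K) (fun i => lift (a i)) P.
have -> : mmap iota a P = cls F.
  rewrite mmap_morph /mmap; apply: eq_bigr => s _; congr (_ * _).
  by apply: eq_bigr => i _; rewrite /= (liftK unparamK).
have [f ->] := T1_cyclic two_neq0 paramK unparamK memI m.
rewrite scalerA -rmorphM mulrC rmorphM -scalerA.
rewrite (_ : cls F *: _ = 0) ?scaler0 //; apply/eps_class_ann.
rewrite mmap_morph -[RHS]hP /comp_mpoly /mmap; apply: eq_bigr => s _.
congr (_ * _); first by rewrite /= /veronese_hom /subst_gen comp_mpolyC.
by apply: eq_bigr => i _; rewrite tnth_mktuple.
Qed.

Theorem T1_pure : pure (T1 I) 4.
Proof.
split; first split; [|exact: T1_dim_le|].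
  exact: (cone_chain (m := eps_class two_neq0 paramK unparamK memI) _ eps_class_neq0).
by move=> N _ [m mN m0]; apply; exact: cone_chain mN m0.
Qed.

End Pure.

(** * Darboux bases *)

Section Darboux.
Variables (K : fieldType) (V : vectType K) (omega : {skew_symmetric V}).
Hypothesis two_neq0 : 2%:R != 0 :> K.
Hypothesis nondeg : nondegenerate omega.
Hypothesis dimV : \dim {:V} = 4%N.

Lemma omegaC u v : omega u v = - omega v u.
Proof. by rewrite [LHS]hermC expr1 mulN1r. Qed.

Lemma omegavv u : omega u u = 0.
Proof.
apply/eqP; have /eqP := omegaC u u; rewrite -addr_eq0 -mulr2n -mulr_natr.
by rewrite mulf_eq0 (negbTE two_neq0) orbF.
Qed.

Lemma omega_nondeg u : (forall w, omega u w = 0) -> u = 0.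
Proof.
move=> h; apply/eqP; rewrite -memv0 -(eqP nondeg).
by apply/mem_orthovP => w _; exact: h.
Qed.

Lemma omega_nondegP u : u != 0 -> exists w, omega u w != 0.
Proof.
move=> u0; apply: contrapT => h; case/eqP: u0; apply: omega_nondeg => w.
by apply/eqP; apply: contrapT => /negP hw; apply: h; exists w.
Qed.

Definition darboux (v : nat -> V) : Prop :=
  forall i j, (i < 4)%N -> (j < 4)%N -> omega (v i) (v j) = symp K i j.

(** Choose a hyperbolic pair, then a second one in its orthogonal complement. *)
Lemma darboux_exists : exists v, darboux v.
Proof.
have e1P : vpick {:V} != 0 by rewrite vpick0 -dimv_eq0 dimV.
set e1 := vpick _ in e1P.
have [f1 w1] : exists f1, omega e1 f1 = 1.
  have [g1 hg1] := omega_nondegP e1P; exists ((omega e1 g1)^-1 *: g1).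
  by rewrite linearZr_LR /= mulVf.
pose W := ({:V} :&: orthov omega <[e1]> :&: orthov omega <[f1]>)%VS.
have Wdim : (1 < \dim W)%N.
  apply: leq_trans (leq_dim_orthov1 _ _ _).
  have := leq_dim_orthov1 omega e1 {:V}; rewrite dimV.
  by case: (\dim _) => [|[|[|?]]].
have e2P : vpick W != 0 by rewrite vpick0 -dimv_eq0 -lt0n ltnW.
have := memv_pick W; set e2 := vpick W in e2P *.
rewrite !memv_cap !mem_orthov1 => /andP[/andP[_ /eqP o1] /eqP o2].
have [g hg] := omega_nondegP e2P.
have w1' : omega f1 e1 = - 1 by rewrite omegaC w1.
have [f2 [F1 F2 F3]] : exists f2, [/\ omega e1 f2 = 0, omega f1 f2 = 0 & omega e2 f2 = 1].
  exists ((omega e2 g)^-1 *: (g + omega f1 g *: e1 - omega e1 g *: f1)).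
  rewrite !linearZr_LR /= !linearBr !linearDr !linearZr_LR /= !omegavv w1 w1' o1 o2.
  rewrite !(mulr0, addr0, subr0, mulr1) subrr mulrN1 subrr mulr0 mulVf //.
exists (nth 0 [:: e1; e2; f1; f2]) => i j.
have o1' : omega e1 e2 = 0 by rewrite omegaC o1 oppr0.
have o2' : omega f1 e2 = 0 by rewrite omegaC o2 oppr0.
have F1' : omega f2 e1 = 0 by rewrite omegaC F1 oppr0.
have F2' : omega f2 f1 = 0 by rewrite omegaC F2 oppr0.
have F3' : omega f2 e2 = - 1 by rewrite omegaC F3.
case: i => [|[|[|[|i]]]] //; case: j => [|[|[|[|j]]]] // _ _; rewrite /symp /=;
  rewrite ?omegavv ?w1 ?w1' ?o1 ?o2 ?o1' ?o2' ?F1 ?F2 ?F3 ?F1' ?F2' ?F3'; ring.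
Qed.

Section Basis.
Variable v : nat -> V.
Hypothesis vP : darboux v.

(** The k-th coordinate in the basis [v]. *)
Definition dual (k : nat) (u : V) : K := \sum_(l < 4) symp K l k * omega (v l) u.

Lemma symp_dual k j : (k < 4)%N -> (j < 4)%N ->
  \sum_(l < 4) symp K l k * symp K l j = (k == j)%:R.
Proof.
move=> hk hj; rewrite !big_ord_recl big_ord0 /symp /=.
by case: k hk => [|[|[|[|k]]]] // _; case: j hj => [|[|[|[|j]]]] // _ /=; ring.
Qed.

Lemma dual_v k j : (k < 4)%N -> (j < 4)%N -> dual k (v j) = (k == j)%:R.
Proof.
move=> hk hj; rewrite /dual -(symp_dual hk hj).
by apply: eq_bigr => l _; rewrite vP.
Qed.

Lemma dual_sum k (a : 'I_4 -> K) (hk : (k < 4)%N) :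
  dual k (\sum_j a j *: v j) = a (Ordinal hk).
Proof.
rewrite /dual; under eq_bigr do rewrite linear_sumr mulr_sumr.
rewrite exchange_big (bigD1 (Ordinal hk)) //= [X in _ + X]big1 ?addr0.
  under eq_bigr do rewrite linearZr_LR /= mulrCA.
  by rewrite -mulr_sumr -/(dual k (v k)) dual_v // eqxx mulr1.
move=> j hj; under eq_bigr do rewrite linearZr_LR /= mulrCA.
rewrite -mulr_sumr -/(dual k (v j)) dual_v //.
by move: hj; rewrite -val_eqE /= eq_sym => /negbTE->; rewrite mulr0.
Qed.

Lemma dual_expand u : u = \sum_(k < 4) dual k u *: v k.
Proof.
pose X := [tuple v i | i < 4].
have fX : free X.
  apply/freeP => a h i; have := dual_sum a (ltn_ord i).
  have -> : \sum_j a j *: v j = 0.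
    by rewrite -[RHS]h; apply: eq_bigr => j _; rewrite -tnth_nth tnth_mktuple.
  rewrite /dual big1 => [|l _]; last by rewrite linear0r mulr0.
  by move=> ->; congr a; apply: val_inj.
have : u \in <<X>>%VS.
  have /eqP -> : (<<X>> == {:V})%VS; last exact: memvf.
  by rewrite eqEdim subvf /= dimV; move: fX; rewrite /free size_tuple => /eqP->.
move=> /coord_span; pose a k := coord X k u.
have -> : \sum_i coord X i u *: X`_i = \sum_(k < 4) a k *: v k.
  by apply: eq_bigr => k _; rewrite -tnth_nth tnth_mktuple.
move=> e; rewrite [LHS]e; apply: eq_bigr => k _.
rewrite [in RHS]e (dual_sum a (ltn_ord k)); congr (a _ *: _).
exact: val_inj.
Qed.

Lemma darboux_ext u u' : (forall j, (j < 4)%N -> omega (v j) u = omega (v j) u') -> u = u'.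
Proof.
move=> h; rewrite [u]dual_expand [u']dual_expand; apply: eq_bigr => k _.
by congr (_ *: _); apply: eq_bigr => l _; rewrite h.
Qed.

(** The endomorphism f with omega (v i) (f (v j)) = b i j. *)
Definition form_map (b : nat -> nat -> K) (u : V) : V :=
  \sum_(q < 4) dual q u *: \sum_(k < 4) (\sum_(l < 4) symp K l k * b l q) *: v k.

Lemma dual_linear k : linear (dual k : V -> K^o).
Proof.
move=> a u w; rewrite /dual scaler_sumr -big_split; apply: eq_bigr => l _ /=.
by rewrite linearDr linearZr_LR /= mulrDr mulrCA.
Qed.

Lemma form_map_linear b : linear (form_map b).
Proof.
move=> a u w; rewrite /form_map scaler_sumr -big_split; apply: eq_bigr => q _ /=.
by rewrite (dual_linear q a u w) scalerDl scalerA.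
Qed.

HB.instance Definition _ b := GRing.isLinear.Build K V V _ (form_map b) (form_map_linear b).

Lemma form_map_v b j : (j < 4)%N ->
  form_map b (v j) = \sum_(k < 4) (\sum_(l < 4) symp K l k * b l j) *: v k.
Proof.
move=> hj; rewrite /form_map (bigD1 (Ordinal hj)) //= dual_v // eqxx scale1r.
rewrite [X in _ + X]big1 ?addr0 // => q; rewrite -val_eqE /= => hq.
by rewrite dual_v // (negbTE hq) scale0r.
Qed.

Lemma omega_form_map b i j : (i < 4)%N -> (j < 4)%N ->
  omega (v i) (form_map b (v j)) = b i j.
Proof.
move=> hi hj; rewrite form_map_v // linear_sumr.
under eq_bigr => k _ do rewrite linearZr_LR /= vP // !big_ord_recl big_ord0.
rewrite !big_ord_recl big_ord0 /symp /=.
by case: i hi => [|[|[|[|i]]]] // _ /=; ring.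
Qed.

Lemma darboux_sp (f : 'End(V)) :
  (forall i j, (i < 4)%N -> (j < 4)%N -> omega (v i) (f (v j)) = omega (v j) (f (v i))) ->
  f \in sp omega.
Proof.
move=> h; apply/mem_sp => u w.
have hw i : (i < 4)%N -> omega (f (v i)) w + omega (v i) (f w) = 0.
  move=> hi; rewrite [w]dual_expand (linear_sum f) !linear_sumr -big_split big1 //= => k _.
  rewrite (linearZ_LR f) /= !linearZr_LR /= -mulrDr [omega (f _) _]omegaC h //.
  by rewrite addNr mulr0.
rewrite [u]dual_expand (linear_sum f) !linear_sumlz -big_split big1 //= => k _.
by rewrite (linearZ_LR f) /= !linearZl_LR /= -mulrDr hw // mulr0.
Qed.

End Basis.
End Darboux.

(** * Linear coordinates on sp(V) *)

Section Coordinates.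
Variables (K : fieldType) (V : vectType K) (omega : {skew_symmetric V}).
Hypothesis two_neq0 : 2%:R != 0 :> K.
Hypothesis nondeg : nondegenerate omega.
Hypothesis dimV : \dim {:V} = 4%N.
Variable v : nat -> V.
Hypothesis vP : darboux omega v.
Local Notation n := (\dim (sp omega)).
Local Notation S := (sp_coord_ring omega).
Local Notation S0 := {mpoly K[10]}.
Local Notation X := (@gen K 9).
Local Notation b := (vbasis (sp omega)).
Local Notation e := (vbasis {:V}).

(** The entry omega (v p) (B (v q)) of S, for the universal element B of sp(V). *)
Definition sp_entry (p q : nat) : S :=
  \sum_(k < n) omega (v p) (b`_k (v q)) *: ('X_k : {mpoly K[n]}).

Lemma sp_sym (f : 'End(V)) p q : f \in sp omega ->
  omega (v p) (f (v q)) = omega (v q) (f (v p)).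
Proof.
move=> /mem_sp/(_ (v q) (v p)) /eqP; rewrite addr_eq0 => /eqP h.
by rewrite [LHS](omegaC) h opprK.
Qed.

Lemma basis_sp (k : 'I_n) : b`_k \in sp omega.
Proof. by apply: vbasis_mem; rewrite mem_nth // size_tuple. Qed.

Lemma sp_entryC p q : sp_entry p q = sp_entry q p.
Proof. by apply: eq_bigr => k _; rewrite sp_sym // basis_sp. Qed.

Definition sym_unit (j p q : nat) : K := (idx p q == j)%:R.

Definition unit_end (j : nat) : 'End(V) := linfun (form_map omega v (sym_unit j)).

Lemma unit_endE j p q : (p < 4)%N -> (q < 4)%N ->
  omega (v p) (unit_end j (v q)) = (idx p q == j)%:R.
Proof. by move=> hp hq; rewrite lfunE /= omega_form_map. Qed.

Lemma idxC p q : idx p q = idx q p.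
Proof. by case: p q => [|[|[|[|[|p]]]]] [|[|[|[|[|q]]]]]. Qed.

Lemma row_col_idx p q : (p < 4)%N -> (q < 4)%N ->
  (row_of (idx p q) = p /\ col_of (idx p q) = q) \/
  (row_of (idx p q) = q /\ col_of (idx p q) = p).
Proof.
by case: p => [|[|[|[|p]]]] //; case: q => [|[|[|[|q]]]] // _ _; auto.
Qed.

Lemma row_of_lt j : (row_of j < 4)%N.
Proof. by do 11 (case: j => [|j] //). Qed.

Lemma col_of_lt j : (col_of j < 4)%N.
Proof. by do 11 (case: j => [|j] //). Qed.

Lemma idx_row_col j : (j < 10)%N -> idx (row_of j) (col_of j) = j.
Proof. by do 10 (case: j => [|j] //). Qed.

Lemma unit_end_sp j : unit_end j \in sp omega.
Proof.
apply: (darboux_sp dimV vP) => p q hp hq.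
by rewrite !unit_endE // idxC.
Qed.

(** An element of sp(V) is determined by its symmetric matrix. *)
Lemma sp_expand (f : 'End(V)) : f \in sp omega ->
  f = \sum_(j < 10) omega (v (row_of j)) (f (v (col_of j))) *: unit_end j.
Proof.
move=> hf; apply/lfunP => u; rewrite [u](dual_expand dimV vP) !linear_sum.
apply: eq_bigr => q _ /=; rewrite !linearZ /=; congr (_ *: _).
apply: (darboux_ext dimV vP) => p hp.
rewrite sum_lfunE linear_sumr.
have hj := idx_lt p q; rewrite (bigD1 (Ordinal hj)) //= big1 ?addr0.
  rewrite scale_lfunE linearZr_LR /= unit_endE // eqxx mulr1.
  by have [[-> ->]|[-> ->]] := row_col_idx hp (ltn_ord q) => //; rewrite sp_sym.
move=> j; rewrite -val_eqE /= eq_sym => /negbTE hne.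
by rewrite scale_lfunE linearZr_LR /= unit_endE // hne mulr0.
Qed.

Definition sp_param : S0 -> S :=
  comp_mpoly [tuple sp_entry (row_of j) (col_of j) | j < 10].

Definition sp_unparam : S -> S0 :=
  comp_mpoly [tuple \sum_(j < 10) coord b k (unit_end j) *: X j | k < n].

HB.instance Definition _ := GRing.RMorphism.copy sp_param
  (comp_mpoly [tuple sp_entry (row_of j) (col_of j) | j < 10]).
HB.instance Definition _ := GRing.Linear.copy sp_param
  (comp_mpoly [tuple sp_entry (row_of j) (col_of j) | j < 10]).
HB.instance Definition _ := GRing.RMorphism.copy sp_unparam
  (comp_mpoly [tuple \sum_(j < 10) coord b k (unit_end j) *: X j | k < n]).
HB.instance Definition _ := GRing.Linear.copy sp_unparam
  (comp_mpoly [tuple \sum_(j < 10) coord b k (unit_end j) *: X j | k < n]).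

Lemma sp_param_gen j : (j < 10)%N -> sp_param (X j) = sp_entry (row_of j) (col_of j).
Proof.
by move=> hj; rewrite /sp_param /gen comp_mpolyXU -tnth_nth tnth_mktuple inordK.
Qed.

Lemma sp_unparam_X (k : 'I_n) :
  sp_unparam ('X_k : {mpoly K[n]}) = \sum_(j < 10) coord b k (unit_end j) *: X j.
Proof. by rewrite /sp_unparam comp_mpolyXU -tnth_nth tnth_mktuple. Qed.

Lemma sp_unparam_entry p q : (p < 4)%N -> (q < 4)%N -> sp_unparam (sp_entry p q) = X (idx p q).
Proof.
move=> hp hq; rewrite /sp_entry linear_sum.
transitivity (\sum_(j < 10) omega (v p) (unit_end j (v q)) *: X j).
  under eq_bigr => k _ do rewrite linearZ /= sp_unparam_X scaler_sumr.
  rewrite exchange_big; apply: eq_bigr => j _ /=.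
  under eq_bigr => k _ do rewrite scalerA.
  rewrite -scaler_suml; congr (_ *: _).
  rewrite {2}(coord_vbasis (unit_end_sp j)) sum_lfunE linear_sumr.
  by apply: eq_bigr => k _; rewrite scale_lfunE linearZr_LR /= mulrC.
have hj := idx_lt p q; rewrite (bigD1 (Ordinal hj)) //= big1 ?addr0.
  by rewrite unit_endE // eqxx scale1r.
by move=> j; rewrite -val_eqE /= unit_endE // eq_sym => /negbTE->; rewrite scale0r.
Qed.

Lemma sp_param_unparam_X (k : 'I_n) : sp_param (sp_unparam ('X_k : {mpoly K[n]})) = 'X_k.
Proof.
rewrite sp_unparam_X linear_sum.
under eq_bigr => j _ do rewrite linearZ /= sp_param_gen // /sp_entry scaler_sumr.
rewrite exchange_big (bigD1 k) //= [X in _ + X]big1 ?addr0 => [|l lk].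
  under eq_bigr => j _ do rewrite scalerA.
  rewrite -scaler_suml.
  have -> : \sum_(j < 10) coord b k (unit_end j) *
      omega (v (row_of j)) (b`_k (v (col_of j))) = coord b k b`_k.
    rewrite [in RHS](sp_expand (basis_sp k)) linear_sum.
    by apply: eq_bigr => j _; rewrite linearZ /= mulrC.
  by rewrite coord_free ?(basis_free (vbasisP _)) // eqxx scale1r.
under eq_bigr => j _ do rewrite scalerA.
rewrite -scaler_suml.
have -> : \sum_(j < 10) coord b k (unit_end j) *
    omega (v (row_of j)) (b`_l (v (col_of j))) = coord b k b`_l.
  rewrite [in RHS](sp_expand (basis_sp l)) linear_sum.
  by apply: eq_bigr => j _; rewrite linearZ /= mulrC.
rewrite coord_free ?(basis_free (vbasisP _)) //.
by move: lk; rewrite -!val_eqE /= => /negbTE h; rewrite ?h 1?eq_sym ?h scale0r.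
Qed.

Lemma mpoly_endo_id m (h : {lrmorphism {mpoly K[m]} -> {mpoly K[m]}}) :
  (forall i, h 'X_i = 'X_i) -> h =1 id.
Proof.
move=> hX p; rewrite [in LHS](mpolyE p) [RHS]mpolyE linear_sum.
apply: eq_bigr => s _; rewrite linearZ /=; congr (_ *: _).
rewrite mpolyXE_id rmorph_prod; apply: eq_bigr => i _.
by rewrite rmorphXn /= hX.
Qed.

Lemma sp_paramK : cancel sp_param sp_unparam.
Proof.
pose h : {lrmorphism S0 -> S0} := sp_unparam \o sp_param.
apply: (@mpoly_endo_id _ h) => i; rewrite -[ i ]inord_val.
change (sp_unparam (sp_param (X i)) = X i); rewrite sp_param_gen //.
by rewrite sp_unparam_entry ?row_of_lt ?col_of_lt // idx_row_col.
Qed.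

Lemma sp_unparamK : cancel sp_unparam sp_param.
Proof.
pose h : {lrmorphism {mpoly K[n]} -> {mpoly K[n]}} := sp_param \o sp_unparam.
exact: (@mpoly_endo_id _ h sp_param_unparam_X).
Qed.

End Coordinates.

(** * The ideal of B^2 = 0 in coordinates *)

Section Ideal.
Variables (K : fieldType) (V : vectType K) (omega : {skew_symmetric V}).
Hypothesis two_neq0 : 2%:R != 0 :> K.
Hypothesis nondeg : nondegenerate omega.
Hypothesis dimV : \dim {:V} = 4%N.
Variable v : nat -> V.
Hypothesis vP : darboux omega v.
Local Notation d := (\dim {:V}).
Local Notation S := (sp_coord_ring omega).
Local Notation S0 := {mpoly K[10]}.
Local Notation X := (@gen K 9).
Local Notation e := (vbasis {:V}).
Local Notation G := (sp_generic omega).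
Local Notation sp_param := (@sp_param K V omega v).
Local Notation sp_unparam := (@sp_unparam K V omega v).

Definition cst (c : K) : S := c%:A.

HB.instance Definition _ := GRing.RMorphism.copy cst (@GRing.in_alg K S).

Lemma cstM c (s : S) : cst c * s = c *: s.
Proof. by rewrite /cst -scalerAl mul1r. Qed.

Definition omega_mx : 'M[S]_(4, d) := \matrix_(p, a) cst (omega (v p) e`_a).
Definition coord_mx : 'M[S]_(d, 4) := \matrix_(a, q) cst (coord e a (v q)).
Definition symp_mx : 'M[S]_4 := \matrix_(p, q) symp S p q.
Definition sp_mx : 'M[S]_4 := \matrix_(p, q) sp_entry omega v p q.

Lemma sp_mxE : sp_mx = omega_mx *m G *m coord_mx.
Proof.
apply/matrixP => p q; rewrite !mxE /sp_entry.
under [RHS]eq_bigr => a _ do rewrite !mxE mulr_suml.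
under [RHS]eq_bigr => a _ do under eq_bigr => c _ do
  rewrite !mxE mulr_sumr mulr_suml.
transitivity (\sum_(a < d) \sum_(c < d) \sum_(k < \dim (sp omega))
   (coord e a (v q) * omega (v p) e`_c * coord e c ((vbasis (sp omega))`_k e`_a))
     *: ('X_k : S)); last first.
  apply: eq_bigr => a _; apply: eq_bigr => c _; apply: eq_bigr => k _.
  by rewrite [RHS]mulrC !cstM !scalerA.
under [RHS]eq_bigr => a _ do rewrite exchange_big /=.
rewrite exchange_big; apply: eq_bigr => k _ /=.
under [RHS]eq_bigr => a _ do rewrite -scaler_suml.
rewrite -scaler_suml; congr (_ *: _).
set f := (vbasis (sp omega))`_k.
rewrite [in LHS](coord_vbasis (memvf (v q))) (linear_sum f) linear_sumr.
apply: eq_bigr => a _ /=.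
rewrite [f (_ *: _)]linearZ linearZr_LR /=.
rewrite [in LHS](coord_vbasis (memvf (f e`_a))) linear_sumr mulr_sumr.
by apply: eq_bigr => c _; rewrite linearZr_LR /= mulrA mulrAC.
Qed.

(** J is minus its own inverse, so expanding a vector in the basis [v] gives minus
    the identity. *)
Lemma insert1 : coord_mx *m symp_mx *m omega_mx = - 1%:M.
Proof.
apply/matrixP => a c; rewrite !mxE.
have := congr1 (coord e a) (dual_expand dimV vP e`_c).
rewrite coord_free ?(basis_free (vbasisP _)) // linear_sum /= => E.
rewrite -[_ *+ _]/(_%:R) -val_eqE eq_sym.
have -> : ((c : nat) == a)%:R = cst ((c : nat) == a)%:R by rewrite rmorph_nat.
rewrite E rmorph_sum -sumrN.
under eq_bigr => l _ do rewrite !mxE mulr_suml.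
rewrite exchange_big; apply: eq_bigr => k _ /=.
have cZ x w : coord e a (x *: w) = x * coord e a w by rewrite linearZ.
rewrite cZ /dual mulr_suml rmorph_sum -sumrN; apply: eq_bigr => l _.
have -> : symp_mx k l = - cst (symp K l k).
  by rewrite mxE symp_morph /symp opprB.
by rewrite mxE !rmorphM /=; ring.
Qed.

(** B is S in terms of [omega_mx] and [coord_mx], and [insert1] removes the middle
    factors. *)
Lemma sqz_entry (p q : 'I_4) : (sp_mx *m symp_mx *m sp_mx) p q =
  - (omega_mx *m (G *m G) *m coord_mx) p q.
Proof.
rewrite sp_mxE.
have -> : omega_mx *m G *m coord_mx *m symp_mx *m (omega_mx *m G *m coord_mx) =
    omega_mx *m G *m (coord_mx *m symp_mx *m omega_mx) *m G *m coord_mx by rewrite !mulmxA.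
by rewrite insert1 mulmxN mulmx1 !mulNmx mxE !mulmxA.
Qed.

Lemma generic_sqE : G *m G =
  - (coord_mx *m symp_mx) *m (sp_mx *m symp_mx *m sp_mx) *m (symp_mx *m omega_mx).
Proof.
rewrite sp_mxE.
transitivity ((coord_mx *m symp_mx *m omega_mx) *m (G *m G) *m (coord_mx *m symp_mx *m omega_mx)).
  by rewrite insert1 !(mulNmx, mulmxN, opprK) mul1mx mulmx1.
have -> : - (coord_mx *m symp_mx) *m (omega_mx *m G *m coord_mx *m symp_mx *m (omega_mx *m G *m coord_mx)) *m (symp_mx *m omega_mx) =
  - ((coord_mx *m symp_mx *m omega_mx) *m G *m (coord_mx *m symp_mx *m omega_mx) *m G *m (coord_mx *m symp_mx *m omega_mx)).
  by rewrite !mulNmx !mulmxA.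
by rewrite insert1 !(mulNmx, mulmxN, mul1mx, mulmx1, opprK).
Qed.

Definition sqz_row (k : nat) : 'I_4 := inord (nth 0 [:: 0; 0; 0; 1; 1; 2] k)%N.
Definition sqz_col (k : nat) : 'I_4 := inord (nth 0 [:: 1; 2; 3; 2; 3; 3] k)%N.

Lemma sqz_matrix (x : nat -> S) (M : 'M[S]_4) (p q : 'I_4) :
  (forall p q : 'I_4, M p q = x (idx p q)) ->
  (M *m symp_mx *m M) p q =
    \sum_(k < 4) \sum_(l < 4) x (idx p l) * symp S l k * x (idx k q).
Proof.
move=> hM; rewrite mxE; apply: eq_bigr => k _; rewrite mxE mulr_suml.
by apply: eq_bigr => l _; rewrite !hM !mxE.
Qed.

Lemma sqz_as_entry (x : nat -> S) (M : 'M[S]_4) k :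
  (forall p q : 'I_4, M p q = x (idx p q)) -> (k < 6)%N ->
  sqz x k = (M *m symp_mx *m M) (sqz_row k) (sqz_col k).
Proof.
move=> hM; rewrite (sqz_matrix _ _ hM) !big_ord_recl !big_ord0 /sqz_row /sqz_col.
case: k => [|[|[|[|[|[|k]]]]]] //= _; rewrite !inordK //= /bump /idx /symp /sqz /=; ring.
Qed.

Lemma entry_as_sqz (x : nat -> S) (M : 'M[S]_4) (p q : 'I_4) :
  (forall p q : 'I_4, M p q = x (idx p q)) ->
  exists a k, (M *m symp_mx *m M) p q = a * sqz x k.
Proof.
move=> hM; rewrite (sqz_matrix _ _ hM) !big_ord_recl !big_ord0 /symp /=.
case: p q => [[|[|[|[|p]]]] hp] // [[|[|[|[|q]]]] hq] //=; rewrite /bump /idx /=.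
- by exists 0, 0%N; ring.
- by exists 1, 0%N; rewrite /sqz /=; ring.
- by exists 1, 1%N; rewrite /sqz /=; ring.
- by exists 1, 2%N; rewrite /sqz /=; ring.
- by exists (-1), 0%N; rewrite /sqz /=; ring.
- by exists 0, 0%N; ring.
- by exists 1, 3%N; rewrite /sqz /=; ring.
- by exists 1, 4%N; rewrite /sqz /=; ring.
- by exists (-1), 1%N; rewrite /sqz /=; ring.
- by exists (-1), 3%N; rewrite /sqz /=; ring.
- by exists 0, 0%N; ring.
- by exists 1, 5%N; rewrite /sqz /=; ring.
- by exists (-1), 2%N; rewrite /sqz /=; ring.
- by exists (-1), 4%N; rewrite /sqz /=; ring.
- by exists (-1), 5%N; rewrite /sqz /=; ring.
- by exists 0, 0%N; ring.
Qed.

Definition coords (j : nat) : S := sp_param (X j).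

Lemma sp_mx_coords (p q : 'I_4) : sp_mx p q = coords (idx p q).
Proof.
rewrite mxE /coords sp_param_gen ?idx_lt //.
by have [[-> ->]|[-> ->]] := row_col_idx (ltn_ord p) (ltn_ord q) => //; rewrite sp_entryC.
Qed.

Lemma sp_param_sqz k : sp_param (sqz X k) = sqz coords k.
Proof. by rewrite quad_morph; apply: eq_quad => i j _ _; rewrite [LHS]rmorphM. Qed.

Lemma generic_sq_span i j : sqz_span X (sp_unparam ((G *m G) i j)).
Proof.
have sum4 (F : 'I_4 -> S0) : (forall p, sqz_span X (F p)) -> sqz_span X (\sum_p F p).
  move=> h; elim/big_ind: _ => [|a b|p _]; [exact: sqz_span0|exact: sqz_spanD|exact: h].
rewrite generic_sqE mxE rmorph_sum; apply: (sum4) => q.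
rewrite rmorphM /= mulrC; apply: sqz_spanM.
rewrite mxE rmorph_sum; apply: (sum4) => p; rewrite rmorphM /=; apply: sqz_spanM.
have [a [k ->]] := entry_as_sqz p q sp_mx_coords.
rewrite rmorphM /= -sp_param_sqz (sp_paramK dimV vP); apply/sqz_spanM/sqz_span_gen.
Qed.

Lemma generic_sq_mem i j : (G *m G) i j \in sqzero_ideal omega.
Proof.
apply/asboolP; exists (delta_mx i j).
rewrite (bigD1 i) //= (bigD1 j) //= [delta_mx _ _ _ _]mxE !eqxx mul1r big1 ?addr0; last first.
  by move=> l /negbTE h; rewrite [delta_mx _ _ _ _]mxE h andbF mul0r.
rewrite big1 ?addr0 // => l /negbTE h; rewrite big1 // => m _.
by rewrite [delta_mx _ _ _ _]mxE h mul0r.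
Qed.

Lemma sqzero_idealE s : s \in sqzero_ideal omega <-> sqz_span X (sp_unparam s).
Proof.
split=> [/asboolP[c ->]|[c hc]].
  rewrite rmorph_sum; elim/big_ind: _ => [|a b|i _]; [exact: sqz_span0|exact: sqz_spanD|].
  rewrite rmorph_sum; elim/big_ind: _ => [|a b|j _]; [exact: sqz_span0|exact: sqz_spanD|].
  by rewrite rmorphM; apply/sqz_spanM/generic_sq_span.
rewrite -[s](sp_unparamK dimV vP) hc rmorph_sum; apply: rpred_sum => k _.
rewrite rmorphM; apply: idealMr; rewrite /= sp_param_sqz.
rewrite (sqz_as_entry sp_mx_coords (ltn_ord k)) sqz_entry rpredN.
rewrite mxE; apply: rpred_sum => j _; rewrite mulrC; apply: idealMr.
by rewrite mxE; apply: rpred_sum => i _; apply/idealMr/generic_sq_mem.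
Qed.

End Ideal.

Theorem mainTheorem3 (R : realType) (V : vectType R[i])
  (omega : {skew_symmetric V}) (omegaP : is_psymplectic omega)
  (dimV : \dim {:V} = 4%N) :
  pure (T1 (sqzero_ideal omega)) 4.
Proof.
have two_neq0 : 2%:R != 0 :> R[i] by rewrite Num.Theory.pnatr_eq0.
have [nondeg _ _] := omegaP.
have [v vP] := darboux_exists two_neq0 nondeg dimV.
exact: (T1_pure two_neq0 (sp_paramK dimV vP) (sp_unparamK dimV vP) (sqzero_idealE dimV vP)).
Qed.
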